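(* For each fixed $\bar\theta\in\mathcal P$, write $K,M,D,\eta,\rho$ for $K(\bar\theta),M(\bar\theta),D(\bar\theta),\eta(\bar\theta),\rho(\bar\theta)$. The frozen system $$\dot v=(CK+AD-M)v,\qquad \dot A=\eta C-A\,\mathbf 1^\top Dv-\rho A,\qquad C=1-\mathbf 1^\top v-A,\qquad v=(L,R)^\top,$$ has a unique radical-free equilibrium (i.e. equilibrium with $L=R=0$), namely $$E^\dagger(\bar\theta)=(0,0,A^\dagger),\qquad A^\dagger=\frac{\eta}{\eta+\rho}\in(0,1),\qquad C^\dagger=1-A^\dagger=\frac{\rho}{\eta+\rho}\in(0,1).$$ The Jacobian at $E^\dagger(\bar\theta)$ is block triangular (with respect to the splitting of the variables into $v=(L,R)$ and $A$), with radical block $$J_{\mathrm{rad}}(\bar\theta)=C^\dagger K(\bar\theta)+A^\dagger D(\bar\theta)-M(\bar\theta).$$ Define $$\mathcal R_{\mathrm{LA}}(\bar\theta):=\lambda_{\mathrm{PF}}\Bigl(M(\bar\theta)^{-1}\bigl[C^\dagger K(\bar\theta)+A^\dagger D(\bar\theta)\bigr]\Bigr).$$ Then: $$\mathcal R_{\mathrm{LA}}(\bar\theta)<1\iff E^\dagger(\bar\theta)\text{ is locally asymptotically stable},$$ $$\mathcal R_{\mathrm{LA}}(\bar\theta)=1\iff E^\dagger(\bar\theta)\text{ is nonhyperbolic},$$ $$\mathcal R_{\mathrm{LA}}(\bar\theta)>1\iff E^\dagger(\bar\theta)\text{ is unstable}.$$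
   Context: The state space is the simplex $\mathcal T=\{(L,R,A)\in\mathbb R^3: L\ge0,\ R\ge0,\ A\ge0,\ L+R+A\le1\}$, and $C:=1-L-R-A$. Parameters are $\theta=(\alpha_L,\alpha_R,\gamma_{LR},\gamma_{RL},\mu_L,\mu_R,\delta_L,\delta_R,\eta,\rho)\in\mathcal P$, where $\mathcal P\subset\mathbb R^{10}$ is a compact convex set all of whose points have strictly positive entries. For $\theta\in\mathcal P$, $$K(\theta)=\begin{pmatrix}\alpha_L&\gamma_{RL}\\ \gamma_{LR}&\alpha_R\end{pmatrix},\quad M(\theta)=\begin{pmatrix}\mu_L&0\\0&\mu_R\end{pmatrix},\quad D(\theta)=\begin{pmatrix}\delta_L&0\\0&\delta_R\end{pmatrix},$$ and $\eta(\theta),\rho(\theta)$ are the last two components of $\theta$. The system is called frozen because the parameter is held constant at $\bar\theta$. $\mathbf 1=(1,1)^\top$. $\lambda_{\mathrm{PF}}(B)$ denotes the Perron--Frobenius eigenvalue (spectral radius) of a matrix $B$ with strictly positive entries.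
   Formalization: As stated the trichotomy fails: nonhyperbolic can occur with R_LA=2, and at R_LA=1 E† may be LAS or unstable. Proved: R_LA=1 iff nonhyperbolic with no eigenvalue of positive real part; the LAS and unstable equivalences assume R_LA≠1 (their spectral versions hold without it). *)

(* Defs.v *)
From HB Require Import structures.
From mathcomp Require Import all_boot all_order all_algebra.
From mathcomp Require Import all_classical all_reals all_analysis.
From mathcomp Require Import complex.

Set Implicit Arguments.
Unset Strict Implicit.
Unset Printing Implicit Defensive.

Import Order.TTheory GRing.Theory Num.Theory.
Import numFieldNormedType.Exports.

Local Open Scope classical_set_scope.
Local Open Scope ring_scope.

Section Spectrum.
Context {R : realType} {n : nat}.
Implicit Type B : 'M[R]_n.

Definition spectrum B : set R[i] :=
  [set z | eigenvalue (map_mx (real_complex R) B) z].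

(* On matrices with strictly positive entries this is the Perron-Frobenius
   eigenvalue. *)
Definition spectral_radius B : R :=
  sup [set ComplexField.Normc.normc z | z in spectrum B].

End Spectrum.

Section Equilibria.
Context {R : realType} {n : nat}.
Implicit Types (F : 'rV[R]_n -> 'rV[R]_n) (X : set 'rV[R]_n) (p : 'rV[R]_n).

Definition is_equilibrium F p := F p = 0.

(* States are row vectors, and the library's [jacobian] acts on row vectors
   from the right; its transpose is the usual matrix (dF_i / dx_j). *)
Definition jacobian_mx F p : 'M[R]_n := (jacobian F p)^T.

Definition nonhyperbolic F p :=
  exists z, spectrum (jacobian_mx F p) z /\ complex.Re z = 0.

Definition linearly_asymptotically_stable F p :=
  forall z, spectrum (jacobian_mx F p) z -> complex.Re z < 0.

Definition linearly_unstable F p :=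
  exists z, spectrum (jacobian_mx F p) z /\ 0 < complex.Re z.

Definition is_solution F X (x : R -> 'rV[R]_n) :=
  [/\ {within `[0, +oo[, continuous x},
      forall t : R, 0 < t -> is_derive t 1 x (F (x t)) &
      forall t : R, 0 <= t -> X (x t)].

(* Stability of p relative to the state space X.  Quantifying over solutions
   defined for all t >= 0 is adequate when X is compact and forward invariant,
   as is the simplex below. *)
Definition lyapunov_stable F X p :=
  forall e : R, 0 < e -> exists2 d : R, 0 < d &
    forall x, is_solution F X x -> `|x 0 - p| < d ->
      forall t : R, 0 <= t -> `|x t - p| < e.

Definition locally_attractive F X p :=
  exists2 d : R, 0 < d &
    forall x, is_solution F X x -> `|x 0 - p| < d -> x t @[t --> +oo] --> p.

Definition locally_asymptotically_stable F X p :=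
  lyapunov_stable F X p /\ locally_attractive F X p.

Definition unstable F X p := ~ lyapunov_stable F X p.

End Equilibria.

Section Model.
Context {R : realType}.

(* Parameters, in the order
   (alphaL, alphaR, gammaLR, gammaRL, muL, muR, deltaL, deltaR, eta, rho). *)
Definition param := 'rV[R]_10.

Implicit Types (th : param) (x : 'rV[R]_(2 + 1)).

Definition alphaL th : R := th 0 (inord 0).
Definition alphaR th : R := th 0 (inord 1).
Definition gammaLR th : R := th 0 (inord 2).
Definition gammaRL th : R := th 0 (inord 3).
Definition muL th : R := th 0 (inord 4).
Definition muR th : R := th 0 (inord 5).
Definition deltaL th : R := th 0 (inord 6).
Definition deltaR th : R := th 0 (inord 7).
Definition eta th : R := th 0 (inord 8).
Definition rho th : R := th 0 (inord 9).

Definition mx22 (a b c d : R) : 'M[R]_2 :=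
  \matrix_(i, j) if i == 0 then if j == 0 then a else b
                 else if j == 0 then c else d.

Definition Kmx th := mx22 (alphaL th) (gammaRL th) (gammaLR th) (alphaR th).
Definition Mmx th := mx22 (muL th) 0 0 (muR th).
Definition Dmx th := mx22 (deltaL th) 0 0 (deltaR th).

(* A state is the row vector (L, R, A), split as v = (L, R) and A. *)
Definition vpart x : 'cV[R]_2 := (lsubmx x)^T.
Definition Apart x : R := rsubmx x 0 0.

Definition ones : 'cV[R]_2 := const_mx 1.

Definition Cpart x : R := 1 - (ones^T *m vpart x) 0 0 - Apart x.

Definition simplexT : set 'rV[R]_(2 + 1) :=
  [set x | (forall i, 0 <= x 0 i) /\ \sum_i x 0 i <= 1].

Definition frozen_field th x : 'rV[R]_(2 + 1) :=
  let v := vpart x in let A := Apart x in let C := Cpart x in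
  row_mx ((C *: Kmx th + A *: Dmx th - Mmx th) *m v)^T
         (const_mx (eta th * C - A * (ones^T *m Dmx th *m v) 0 0 - rho th * A)).

Definition radical_free x := vpart x = 0.

Definition Adag th : R := eta th / (eta th + rho th).
Definition Cdag th : R := 1 - Adag th.
Definition Edag th : 'rV[R]_(2 + 1) := row_mx 0 (const_mx (Adag th)).

Definition Jrad th : 'M[R]_2 :=
  Cdag th *: Kmx th + Adag th *: Dmx th - Mmx th.

Definition RLA th : R :=
  spectral_radius (invmx (Mmx th) *m (Cdag th *: Kmx th + Adag th *: Dmx th)).

End Model.

Arguments param R : clear implicits.
Arguments simplexT {R}.

(* Main.v *)
Require Import Defs.
From mathcomp Require Import all_boot all_order all_algebra.
From mathcomp Require Import all_classical all_reals all_analysis.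
From mathcomp Require Import complex.
From mathcomp Require Import ring lra.

Set Implicit Arguments.
Unset Strict Implicit.
Unset Printing Implicit Defensive.

Import Order.TTheory GRing.Theory Num.Theory.
Import numFieldNormedType.Exports.

Local Open Scope classical_set_scope.
Local Open Scope ring_scope.

(** Why the theorem holds.

    Linear part.  The radical block [Jrad th] is a 2x2 matrix with positive
    off-diagonal entries, so it has a dominant real eigenvalue [l], the root of
    (l - J11)(l - J22) = J12 J21 lying above both diagonal entries; its other
    eigenvalue tr J - l is real and smaller ([pf_root_mx22], [spectrum_mx22]).
    The Jacobian at E is block triangular with remaining eigenvalue
    -(eta + rho) < 0, so its spectral type is decided by the sign of [l].  The
    number r = RLA solves (r muL - N11)(r muR - N22) = N12 N21, where
    N = C K + A D at E and both factors are positive, while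
    (l + muL - N11)(l + muR - N22) = N12 N21.  Since both products have
    positive increasing factors and the same value, l has the sign of r - 1
    ([dominant_eigenvalue]).

    Stability (l < 0).  Let w = (wL, wR) be a positive left eigenvector of the
    radical block for [l], W = w . v the radical mass, and a the deviation of A
    from its equilibrium value.  Then a^2 + W is a Lyapunov function on the
    simplex: W decays at rate -l up to terms of order |a| W, and a is forced
    only by terms of order W.  Hence its derivative is at most -k (a^2 + W)
    near E ([lyap_decrease]); a first-exit argument ([trapping]) and
    Gronwall's inequality ([gronwall_le]) finish the proof.

    Instability (0 < l).  A solution that stays close to E satisfies
    W' >= (l / 2) W, so W grows exponentially, which is absurd in the simplex
    ([dominant_pos_unstable]).  This needs a solution that starts near E with
    W > 0 and exists for all positive times inside the simplex.  With C added as
    a fourth coordinate the system is a quadratic gain-loss master equation on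
    a probability simplex, and it is solved in closed form by a Wild sum
      X(t) = e^(-ct) sum_n (1 - e^(-ct))^n w_n,
    where each w_n is an explicit point of the simplex: it is an average of the
    collision products of w_p and w_(n-1-p).  The power series with
    coefficients w_n satisfies u' = Q(u, u) on [0, 1) by Cauchy's product
    formula, which gives the differential equation; positivity and total mass
    are visible term by term ([is_derive_wild_sum], [frozen_solution]). *)

(** * Cauchy products and power series *)

Lemma sum_triangle (R : comPzRingType) (a b : nat -> R) N :
  \sum_(0 <= n < N) \sum_(m < n.+1) a m * b (n - m)%N =
  \sum_(m < N) a m * \sum_(0 <= k < N - m) b k.
Proof.
elim: N => [|N IH]; first by rewrite big_nil big_ord0.
rewrite big_nat_recr //= IH [in RHS]big_ord_recr /= subSnn big_nat1.
rewrite [in LHS]big_ord_recr /= subnn addrA -big_split /=; congr (_ + _).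
apply: eq_bigr => m _.
by rewrite subSn 1?ltnW // big_nat_recr //= mulrDr.
Qed.

(** Cauchy's product formula for two convergent series with nonnegative terms: the
    N-th partial sum of the product series is below the product of the N-th
    partial sums, which is below the 2N-th partial sum of the product series. *)
Section CauchyProduct.
Context {R : realType}.
Variables (a b : R^nat) (la lb : R).
Hypotheses (a0 : forall n, 0 <= a n) (b0 : forall n, 0 <= b n).
Hypotheses (acvg : series a @ \oo --> la) (bcvg : series b @ \oo --> lb).

Lemma cvg_cauchy_product :
  series (fun n => \sum_(m < n.+1) a m * b (n - m)%N) @ \oo --> la * lb.
Proof.
set c := fun n => _.
have c0 n : 0 <= c n by apply: sumr_ge0 => i _; rewrite mulr_ge0.
have cE N : series c N = \sum_(m < N) a m * series b (N - m)%N.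
  by rewrite /series /= sum_triangle.
have sa0 n : 0 <= series a n by rewrite /series /= sumr_ge0.
have sb0 n : 0 <= series b n by rewrite /series /= sumr_ge0.
have snd (u : R^nat) : (forall n, 0 <= u n) -> nondecreasing_seq (series u).
  by move=> u0; apply/nondecreasing_seqP => n; rewrite seriesEnat /= big_nat_recr //= lerDl.
have ub N : series c N <= series a N * series b N.
  rewrite cE [series a N]/series /= big_mkord mulr_suml.
  by apply: ler_sum => i _; rewrite ler_wpM2l // snd // leq_subr.
have lb2 N : series a N * series b N <= series c (N + N)%N.
  rewrite cE [series a N]/series /= big_mkord mulr_suml big_split_ord /=.
  rewrite -[leLHS]addr0 lerD //; last by apply: sumr_ge0 => i _; rewrite mulr_ge0.
  apply: ler_sum => i _; rewrite ler_wpM2l // snd //.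
  by rewrite leq_subRL ?leq_add2r ?(leq_trans (ltnW (ltn_ord i))) ?leq_addr // ltnW.
have sale n : series a n <= la.
  rewrite -(cvg_lim _ acvg) //; apply: nondecreasing_cvgn_le; first exact: snd.
  by apply/cvg_ex; exists la.
have sble n : series b n <= lb.
  rewrite -(cvg_lim _ bcvg) //; apply: nondecreasing_cvgn_le; first exact: snd.
  by apply/cvg_ex; exists lb.
have cc : cvgn (series c).
  apply: nondecreasing_is_cvgn; first exact: snd.
  exists (la * lb) => _ [n _ <-].
  by apply: le_trans (ub n) _; rewrite ler_pM.
have abcvg : series a n * series b n @[n --> \oo] --> la * lb.
  exact: cvgM.
suff -> : la * lb = limn (series c) by [].
apply/eqP; rewrite eq_le; apply/andP; split.
  rewrite -(cvg_lim _ abcvg) //; apply: limr_le; first by apply/cvg_ex; exists (la * lb).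
  apply: nearW => n; apply: le_trans (lb2 n) _.
  by apply: nondecreasing_cvgn_le => //; exact: snd.
apply: limr_le => //; apply: nearW => n.
by apply: le_trans (ub n) _; rewrite ler_pM.
Qed.

End CauchyProduct.

(** Power series that converge on (-1, 1), such as those with coefficients in
    [0, 1], may be differentiated there term by term. *)
Section BoundedPowerSeries.
Context {R : realType}.
Implicit Types (y : R^nat) (s : R).

Lemma is_cvg_pseries_le1 y s : (forall n, 0 <= y n <= 1) -> `|s| < 1 ->
  cvgn (pseries y s).
Proof.
move=> y01 s1.
have [r /andP[sr r1]] : exists r, `|s| < r < 1.
  by exists ((`|s| + 1) / 2); rewrite midf_lt //= midf_lt.
have r0 : 0 <= r by apply: le_trans (ltW sr).
apply: (@is_cvg_pseries_inside _ _ r); last by rewrite (ger0_norm r0).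
apply: (@series_le_cvg _ _ (geometric 1 r)).
- by move=> n; rewrite mulr_ge0 ?exprn_ge0 //; case/andP: (y01 n).
- by move=> n; rewrite /geometric /= mul1r exprn_ge0.
- move=> n; rewrite /geometric /= ler_wpM2r ?exprn_ge0 //; by case/andP: (y01 n).
- by apply: is_cvg_geometric_series; rewrite ger0_norm.
Qed.

Lemma is_cvg_pseries_diffs_lt1 y :
  (forall s, `|s| < 1 -> cvgn (pseries y s)) ->
  forall s, `|s| < 1 -> cvgn (pseries (pseries_diffs y) s).
Proof.
move=> cy s s1.
pose K := (`|s| + 1) / 2.
have [sK K1] : `|s| < K /\ K < 1 by rewrite /K; split; rewrite midf_lt.
have K0 : 0 < K by apply: le_lt_trans sK.
pose t := `|s| / K.
have t0 : 0 <= t by rewrite divr_ge0 // ltW.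
have t1 : t < 1 by rewrite ltr_pdivrMr ?mul1r.
(* each of the n + 1 terms of the geometric sum up to t^n is at least t^n *)
have tn n : n.+1%:R * t ^+ n <= (1 - t)^-1.
  rewrite -div1r ler_pdivlMr ?subr_gt0 //.
  apply: (@le_trans _ _ ((\sum_(i < n.+1) t ^+ i) * (1 - t))).
    rewrite ler_wpM2r ?subr_ge0 ?(ltW t1) //.
    rewrite -[X in X%:R](card_ord n.+1) -sum1_card natr_sum mulr_suml.
    apply: ler_sum => i _; rewrite mul1r ler_wiXn2l ?(ltW t1) //.
    by rewrite -ltnS.
  rewrite mulrC -opprB mulNr -subrX1 opprB lerBlDr lerDl exprn_ge0 //.
have cK : cvgn (pseries (fun i => `|y i|) K).
  apply: (@is_cvg_pseries_inside_norm _ y ((K + 1) / 2)).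
    by apply: cy; rewrite ger0_norm ?midf_lt // divr_ge0 // addr_ge0 // ltW.
  rewrite !ger0_norm ?midf_lt // ?ltW // divr_gt0 // addr_gt0 //.
apply: normed_cvg.
apply: (@series_le_cvg _ _ (fun n => ((1 - t)^-1 / K) * (`|y n.+1| * K ^+ n.+1)))
  => [n|n|n|]; first exact: normr_ge0.
- by rewrite /= !mulr_ge0 ?invr_ge0 ?subr_ge0 ?exprn_ge0 // ltW.
- rewrite /pseries_diffs /= !normrM normrX ger0_norm //.
  have -> : `|s| = t * K by rewrite divfK // gt_eqF.
  rewrite exprMn exprS.
  have -> : (1 - t)^-1 / K * (`|y n.+1| * (K * K ^+ n)) = (1 - t)^-1 * (`|y n.+1| * K ^+ n).
    rewrite -mulrA; congr (_ * _); field; exact: lt0r_neq0.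
  have -> : n.+1%:R * `|y n.+1| * (t ^+ n * K ^+ n) = n.+1%:R * t ^+ n * (`|y n.+1| * K ^+ n) by ring.
  by rewrite ler_wpM2r ?mulr_ge0 ?exprn_ge0 // ltW.
- apply: is_cvg_seriesZ.
  rewrite (_ : series _ = fun n => pseries (fun i => `|y i|) K n.+1 - `|y 0%N|).
    apply: is_cvgB; last exact: is_cvg_cst.
    apply/cvg_ex; exists (limn (pseries (fun i => `|y i|) K)).
    by rewrite (cvg_shiftS (pseries _ K)).
  apply/funext => n; rewrite /pseries /series /= big_nat_recl //= expr0 mulr1.
  by rewrite addrC addKr.
Qed.

Lemma is_derive_pseries_lt1 y s :
  (forall s, `|s| < 1 -> cvgn (pseries y s)) -> `|s| < 1 ->
  is_derive s (1 : R) (fun s => limn (pseries y s))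
    (limn (pseries (pseries_diffs y) s)).
Proof.
move=> cy s1.
pose K := (`|s| + 1) / 2.
have [sK K1] : `|s| < K /\ K < 1 by rewrite /K; split; rewrite midf_lt.
have K0 : 0 < K by apply: le_lt_trans sK.
have nK : `|K| = K by rewrite ger0_norm // ltW.
have cd := is_cvg_pseries_diffs_lt1 cy.
apply: (@pseries_snd_diffs _ _ K); rewrite ?nK //.
- by apply: cy; rewrite nK.
- by apply: cd; rewrite nK.
- by apply: (is_cvg_pseries_diffs_lt1 cd); rewrite nK.
Qed.
End BoundedPowerSeries.

(** * Wild sums *)

Lemma cvg_bigsum (R : realType) (J : finType) (f : J -> R^nat) (l : J -> R) :
  (forall j, f j @ \oo --> l j) ->
  (\sum_j f j n) @[n --> \oo] --> \sum_j l j.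
Proof.
move=> fl; elim: (index_enum J) => [|j s IH].
  rewrite big_nil; under eq_fun do rewrite big_nil; exact: cvg_cst.
rewrite big_cons; under eq_fun do rewrite big_cons; exact: cvgD.
Qed.

(** Let [g i k j] be the rate at which particles of species i turn into species k
    when they meet species j, and let [x0] be a probability vector.  This section
    constructs a solution, global in positive time, of the gain-loss equation
      X_k' = sum_(i, j) g i k j X_i X_j - sum_(i, j) g k i j X_k X_j
    with X(0) = x0 that stays in the probability simplex. *)
Section WildSum.
Context {R : realType} {I : finType}.
Variables (g : I -> I -> I -> R) (x0 : I -> R).
Hypothesis g0 : forall i k j, 0 <= g i k j.
Hypotheses (x00 : forall i, 0 <= x0 i) (x01 : \sum_i x0 i = 1).

(** A rate that dominates the total rate of change of every species. *)
Definition wild_clock : R := 1 + \sum_i \sum_j \sum_k g i k j.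
Local Notation c := wild_clock.

(** Uniformization: the probability that a collision of an i-particle with a
    j-particle at rate [wild_clock] leaves the i-particle in species k.  The
    diagonal rates [g i i j] cancel. *)
Definition wild_kernel i j k : R :=
  (i == k)%:R * (1 - (\sum_l g i l j) / c) + g i k j / c.
Local Notation q := wild_kernel.

(** The normalized quadratic operator Q(y, z); in terms of it the equation reads
    X' = c (Q(X, X) - X) on the simplex. *)
Definition wild_collision (y z : I -> R) (k : I) : R :=
  \sum_i \sum_j q i j k * (y i * z j).

(** The terms w_0, ..., w_n of the Wild sum.  The recursion
    (n + 1) w_(n+1) = sum_(p <= n) Q(w_p, w_(n-p)) refers to all previous terms,
    hence the whole list is built; the default value [x0] of [nth] is never used
    out of range. *)
Fixpoint wild_prefix (n : nat) : seq (I -> R) :=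
  if n is m.+1 then
    let s := wild_prefix m in
    rcons s (fun k => m.+1%:R^-1 *
      \sum_(p < m.+1) wild_collision (nth x0 s p) (nth x0 s (m - p)) k)
  else [:: x0].

Definition wild_term n : I -> R := nth x0 (wild_prefix n) n.
Local Notation w := wild_term.

Lemma wild_clock_gt0 : 0 < c.
Proof.
rewrite /wild_clock ltr_pwDl //.
by do 3! (apply: sumr_ge0 => ? _).
Qed.

Lemma wild_kernel_ge0 i j k : 0 <= q i j k.
Proof.
have cp := wild_clock_gt0.
rewrite /wild_kernel addr_ge0 ?divr_ge0 // ?(ltW cp) // mulr_ge0 // subr_ge0.
rewrite ler_pdivrMr // mul1r /wild_clock.
apply: (@le_trans _ _ (\sum_j' \sum_k' g i k' j')).
  by rewrite [leRHS](bigD1 j) //= lerDl; do 2!(apply: sumr_ge0 => ? _).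
apply: ler_wpDl => //.
by rewrite [leRHS](bigD1 i) //= lerDl; do 3!(apply: sumr_ge0 => ? _).
Qed.

Lemma wild_kernel_sum i j : \sum_k q i j k = 1.
Proof.
rewrite /wild_kernel big_split /= (bigD1 i) //= eqxx mul1r [X in _ + X + _]big1 ?addr0.
  by rewrite -mulr_suml subrK.
by move=> k ki; rewrite eq_sym (negbTE ki) mul0r.
Qed.

Lemma size_wild_prefix n : size (wild_prefix n) = n.+1.
Proof. by elim: n => //= n IH; rewrite size_rcons IH. Qed.

Lemma nth_wild_prefix n m : (m <= n)%N -> nth x0 (wild_prefix n) m = w m.
Proof.
elim: n => [|n IH]; first by rewrite leqn0 => /eqP ->.
rewrite leq_eqVlt => /predU1P[-> //|]; rewrite ltnS => mn /=.
by rewrite nth_rcons size_wild_prefix ltnS mn IH.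
Qed.

Lemma wild_termS n k :
  n.+1%:R * w n.+1 k = \sum_(p < n.+1) wild_collision (w p) (w (n - p)%N) k.
Proof.
rewrite /wild_term [wild_prefix n.+1]/= nth_rcons size_wild_prefix ltnn eqxx.
rewrite mulVKf ?pnatr_eq0 //; apply: eq_bigr => p _.
by rewrite !nth_wild_prefix // ?leq_subr // -ltnS.
Qed.

Lemma wild_collision_ge0 y z k : (forall i, 0 <= y i) -> (forall i, 0 <= z i) ->
  0 <= wild_collision y z k.
Proof.
move=> y0 z0; do 2!(apply: sumr_ge0 => ? _).
by rewrite !mulr_ge0 // wild_kernel_ge0.
Qed.

Lemma wild_collision_sum y z :
  \sum_k wild_collision y z k = (\sum_i y i) * (\sum_i z i).
Proof.
rewrite exchange_big mulr_suml; apply: eq_bigr => i _ /=.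
rewrite exchange_big mulr_sumr; apply: eq_bigr => j _ /=.
by rewrite -mulr_suml wild_kernel_sum mul1r.
Qed.

(** Every term lies in the simplex, since Q maps pairs of probability vectors to
    probability vectors and w_(n+1) is an average of such values. *)
Lemma wild_term_simplex n : (forall k, 0 <= w n k) /\ \sum_k w n k = 1.
Proof.
elim/ltn_ind: n => -[//|n] IH.
have n0 : (0 : R) < n.+1%:R by [].
split=> [k|].
  rewrite -(pmulr_rge0 _ n0) wild_termS; apply: sumr_ge0 => p _.
  apply: wild_collision_ge0; first by case: (IH p).
  by case: (IH (n - p)%N); rewrite // ltnS leq_subr.
apply: (mulfI (lt0r_neq0 n0)); rewrite mulr1 mulr_sumr.
under eq_bigr do rewrite wild_termS.
rewrite exchange_big /= (eq_bigr (fun=> 1)) => [|p _].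
  by rewrite sumr_const card_ord.
rewrite wild_collision_sum (IH p _).2 // mul1r.
by case: (IH (n - p)%N); rewrite // ltnS leq_subr.
Qed.

Lemma wild_term_le1 k n : 0 <= w n k <= 1.
Proof.
have [w0 w1] := wild_term_simplex n.
by rewrite w0 -w1 (bigD1 k) //= lerDl sumr_ge0.
Qed.

Lemma is_cvg_wild k (s : R) : `|s| < 1 -> cvgn (pseries (w^~ k) s).
Proof. by apply: is_cvg_pseries_le1; exact: wild_term_le1. Qed.

(** The generating function u(s) = sum_n w_n s^n, convergent for |s| < 1. *)
Definition wild_gen k (s : R) : R := limn (pseries (w^~ k) s).
Local Notation u := wild_gen.

Lemma wild_gen_ge0 k (s : R) : 0 <= s < 1 -> 0 <= u k s.
Proof.
case/andP=> s0 s1; apply: limr_ge; first by apply: is_cvg_wild; rewrite ger0_norm.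
apply: nearW => n; rewrite /pseries /series /= sumr_ge0 // => m _.
by rewrite mulr_ge0 ?exprn_ge0 //; case/andP: (wild_term_le1 k m).
Qed.

Lemma wild_gen_sum (s : R) : 0 <= s < 1 -> \sum_k u k s = (1 - s)^-1.
Proof.
case/andP=> s0 s1; have ns1 : `|s| < 1 by rewrite ger0_norm.
have h1 : (\sum_k pseries (w^~ k) s n) @[n --> \oo] --> \sum_k u k s.
  by apply: cvg_bigsum => k; exact: is_cvg_wild.
have h2 := @cvg_geometric_series R 1 s ns1.
rewrite div1r in h2; apply: cvg_unique h1 _ => //.
rewrite (_ : (fun n => _) = series (geometric 1 s)) //.
apply/funext => n; rewrite /pseries /series /= exchange_big /=.
apply: eq_bigr => m _; rewrite -mulr_suml (wild_term_simplex m).2 //.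
Qed.

Lemma wild_gen0 k : u k 0 = x0 k.
Proof.
apply: cvg_lim => //; rewrite -cvg_shiftS /=.
rewrite (_ : (fun n => _) = cst (x0 k)); first exact: cvg_cst.
apply/funext => n; rewrite /pseries /series /= big_nat_recl //= expr0 mulr1.
by rewrite big1 ?addr0 // => i _; rewrite expr0n mulr0.
Qed.

(** The recursion for [wild_term] says that u' = Q(u, u). *)
Lemma is_derive_wild_gen k (s : R) : 0 <= s < 1 ->
  is_derive s (1 : R) (u k) (\sum_i \sum_j q i j k * (u i s * u j s)).
Proof.
case/andP=> s0 s1; have ns1 : `|s| < 1 by rewrite ger0_norm.
have -> : \sum_i \sum_j q i j k * (u i s * u j s) =
    limn (pseries (pseries_diffs (w^~ k)) s).
  apply/esym/cvg_lim => //.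
  rewrite (_ : pseries _ s = fun n => \sum_i \sum_j q i j k *
      series (fun n => \sum_(p < n.+1) (w p i * s ^+ p) * (w (n - p)%N j * s ^+ (n - p))) n).
    apply: cvg_bigsum => i; apply: cvg_bigsum => j.
    apply: cvgM; first exact: cvg_cst.
    apply: (@cvg_cauchy_product _ (fun n => w n i * s ^+ n) (fun n => w n j * s ^+ n)).
    - by move=> n; rewrite mulr_ge0 ?exprn_ge0 //; case/andP: (wild_term_le1 i n).
    - by move=> n; rewrite mulr_ge0 ?exprn_ge0 //; case/andP: (wild_term_le1 j n).
    - exact: is_cvg_wild.
    - exact: is_cvg_wild.
  apply/funext => N; rewrite /pseries /series /=.
  under [RHS]eq_bigr => i _ do (under eq_bigr => j _ do rewrite mulr_sumr; rewrite exchange_big).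
  rewrite exchange_big /=; apply: eq_bigr => n _.
  rewrite /pseries_diffs wild_termS mulr_suml /wild_collision.
  under [RHS]eq_bigr => i _ do (under eq_bigr => j _ do rewrite mulr_sumr; rewrite exchange_big).
  rewrite exchange_big /=; apply: eq_bigr => p _.
  rewrite mulr_suml; apply: eq_bigr => i _.
  rewrite mulr_suml; apply: eq_bigr => j _.
  have -> : s ^+ n = s ^+ p * s ^+ (n - p) by rewrite -exprD subnKC // -ltnS.
  ring.
by apply: is_derive_pseries_lt1 => // z; exact: is_cvg_wild.
Qed.

(** The solution X(t) = e^(-ct) u(1 - e^(-ct)). *)
Definition wild_sum (t : R) k : R := expR (- (c * t)) * u k (1 - expR (- (c * t))).

Lemma wild_arg (t : R) : 0 <= t -> 0 <= 1 - expR (- (c * t)) < 1.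
Proof.
move=> t0; rewrite subr_ge0 ltrBlDr ltrDl expR_gt0 andbT.
by rewrite -expR0 ler_expR oppr_le0 mulr_ge0 // ltW // wild_clock_gt0.
Qed.

Lemma wild_sum0 k : wild_sum 0 k = x0 k.
Proof. by rewrite /wild_sum mulr0 oppr0 expR0 subrr mul1r wild_gen0. Qed.

Lemma wild_sum_ge0 (t : R) k : 0 <= t -> 0 <= wild_sum t k.
Proof.
by move=> t0; rewrite mulr_ge0 ?expR_ge0 // wild_gen_ge0 // wild_arg.
Qed.

Lemma wild_sum_sum (t : R) : 0 <= t -> \sum_k wild_sum t k = 1.
Proof.
move=> t0; rewrite -mulr_sumr wild_gen_sum ?wild_arg // opprB addrC subrK.
by rewrite divff // gt_eqF // expR_gt0.
Qed.

Lemma is_derive_wild_sum (t : R) k : 0 <= t ->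
  is_derive t (1 : R) (wild_sum^~ k)
    (\sum_i \sum_j g i k j * (wild_sum t i * wild_sum t j) -
     \sum_i \sum_j g k i j * (wild_sum t k * wild_sum t j)).
Proof.
move=> t0.
have cp := wild_clock_gt0.
have de : is_derive t (1 : R) (fun t => expR (- (c * t))) (- c * expR (- (c * t))).
  have d1 : is_derive t (1 : R) (fun t => - (c * t)) (- c).
    by apply: is_derive_eq; rewrite /GRing.scale /= mulr1.
  have := @is_derive1_comp _ expR (fun t => - (c * t)) t _ _ (is_derive_expR _) d1.
  by rewrite mulrC.
have ds : is_derive t (1 : R) (fun t => 1 - expR (- (c * t))) (c * expR (- (c * t))).
  by apply: is_derive_eq; rewrite add0r mul1r mulNr opprK.
have du := @is_derive1_comp _ (u k) (fun t => 1 - expR (- (c * t))) t _ _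
  (is_derive_wild_gen k (wild_arg t0)) ds.
have := is_deriveM de du.
move/is_derive_eq; apply.
rewrite /GRing.scale /=.
set e := expR _; set s := 1 - e.
have e0 : e != 0 by rewrite gt_eqF // expR_gt0.
set S := \sum_i \sum_j _.
have -> : e * (S * (c * e)) + u k s * (- c * e) = c * (e * e * S - e * u k s) by ring.
have -> : e * e * S = \sum_i \sum_j q i j k * (wild_sum t i * wild_sum t j).
  rewrite mulr_sumr; apply: eq_bigr => i _.
  rewrite mulr_sumr; apply: eq_bigr => j _.
  rewrite /wild_sum -/e -/s; ring.
rewrite -/(wild_sum t k).
move: (wild_sum_sum t0); set x := wild_sum t => x1.
have -> : \sum_i \sum_j q i j k * (x i * x j) =
  x k - (\sum_i \sum_j g k i j * (x k * x j)) / c + (\sum_i \sum_j g i k j * (x i * x j)) / c.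
  under eq_bigr => i _ do under eq_bigr => j _ do rewrite /wild_kernel mulrDl.
  under eq_bigr => i _ do rewrite big_split.
  rewrite big_split /=; congr (_ + _); last first.
    rewrite mulr_suml; apply: eq_bigr => i _.
    rewrite mulr_suml; apply: eq_bigr => j _; ring.
  rewrite (bigD1 k) //= eqxx [X in _ + X]big1 ?addr0; last first.
    by move=> i ik; rewrite (negbTE ik) big1 // => j _; rewrite !mul0r.
  under eq_bigr do rewrite mul1r mulrBl mul1r.
  rewrite sumrB -mulr_sumr x1 mulr1 exchange_big mulr_suml; congr (_ - _).
  by apply: eq_bigr => j _; rewrite mulrAC mulr_suml.
field; exact: lt0r_neq0.
Qed.

End WildSum.

(** * Spectra of 2x2 and block triangular matrices *)

Section Spectrum.
Context {R : realType}.
Local Notation toC := (real_complex R).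

Lemma spectrum_det n (B : 'M[R]_n) (z : R[i]) :
  spectrum B z <-> \det (map_mx toC B - z%:M) = 0.
Proof.
rewrite /spectrum /= /eigenvalue /eigenspace kermx_eq0 row_free_unit unitmxE unitfE negbK.
by split => /eqP.
Qed.

Lemma spectrum_lblock m n (B : 'M[R]_(m + n)) (z : R[i]) : ursubmx B = 0 ->
  spectrum B z <-> spectrum (ulsubmx B) z \/ spectrum (drsubmx B) z.
Proof.
move=> B0; rewrite !spectrum_det -[in X in X <-> _](submxK B) B0.
rewrite map_block_mx map_mx0 scalar_mx_block opp_block_mx add_block_mx subr0.
rewrite det_lblock; split=> [/eqP|[]->]; rewrite ?mul0r ?mulr0 //.
by rewrite mulf_eq0 => /orP[]/eqP; [left|right].
Qed.

Lemma spectrum11 (B : 'M[R]_1) (z : R[i]) : spectrum B z <-> z = toC (B 0 0).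
Proof.
rewrite spectrum_det det_mx11 !mxE eqxx mulr1n; split=> [/eqP|->]; last by rewrite subrr.
by rewrite subr_eq0 => /eqP.
Qed.

Lemma spectrum_mx22 (a b c d l : R) (z : R[i]) : (l - a) * (l - d) = b * c ->
  spectrum (mx22 a b c d) z <-> z = toC l \/ z = toC (a + d - l).
Proof.
move=> hl; rewrite spectrum_det.
have -> : \det (map_mx toC (mx22 a b c d) - z%:M) = (z - toC l) * (z - toC (a + d - l)).
  rewrite (expand_det_row _ ord0) !big_ord_recl big_ord0 /cofactor !det_mx11 !mxE /=.
  rewrite /= !mulr1n !mulr0n !expr0.
  have hC : (toC l - toC a) * (toC l - toC d) = toC b * toC c by rewrite -!rmorphB -!rmorphM hl.
  rewrite rmorphB rmorphD /= !subr0.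
  rewrite /bump /= addn0 expr1 mulN1r.
  apply/eqP; rewrite -subr_eq0 -(subrr (toC b * toC c)) -[X in _ == X - _]hC; apply/eqP.
  ring.
split=> [/eqP|[]->]; rewrite ?subrr ?mul0r ?mulr0 //.
by rewrite mulf_eq0 !subr_eq0 => /orP[]/eqP; [left|right].
Qed.

(** The dominant eigenvalue of a 2x2 matrix whose off-diagonal entries have
    positive product: the root of the characteristic polynomial that exceeds both
    diagonal entries. *)
Lemma pf_root_mx22 (a b c d : R) : 0 < b * c ->
  {l | [/\ (l - a) * (l - d) = b * c, a < l & d < l]}.
Proof.
move=> bc.
pose s := Num.sqrt ((a - d) ^+ 2 + 4 * (b * c)).
have s0 : 0 <= s by exact: sqrtr_ge0.
have s2 : s ^+ 2 = (a - d) ^+ 2 + 4 * (b * c).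
  by rewrite sqr_sqrtr // addr_ge0 ?sqr_ge0 // mulr_ge0 // ltW.
have [h1 h2] : a - d < s /\ d - a < s.
  by split; rewrite ltNge; apply/negP => h; nra.
exists ((a + d + s) / 2); split; [|lra|lra].
have -> : ((a + d + s) / 2 - a) * ((a + d + s) / 2 - d) = (s ^+ 2 - (a - d) ^+ 2) / 4.
  by field.
by rewrite s2; field.
Qed.

Lemma spectral_radius_mx22 (a b c d l : R) : 0 <= a -> 0 <= d ->
  (l - a) * (l - d) = b * c -> a < l -> d < l ->
  spectral_radius (mx22 a b c d) = l.
Proof.
move=> a0 d0 hl al dl.
have nC (x : R) : ComplexField.Normc.normc (toC x) = `|x|.
  by rewrite /= expr0n addr0 sqrtr_sqr.
rewrite /spectral_radius.
have ub : ubound [set ComplexField.Normc.normc z | z in spectrum (mx22 a b c d)] l.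
  move=> _ [z /(spectrum_mx22 _ hl) [] -> <-]; rewrite nC ler_norml; lra.
have inS : [set ComplexField.Normc.normc z | z in spectrum (mx22 a b c d)] l.
  exists (toC l); first by apply/(spectrum_mx22 _ hl); left.
  by rewrite nC ger0_norm //; lra.
apply/eqP; rewrite eq_le; apply/andP; split.
  by apply: ge_sup => //; exists l.
by apply: ub_le_sup => //; exists l.
Qed.
End Spectrum.

(** * Coordinates and differentials *)

Section MatrixNorm.
Context {R : realType} {m n : nat}.
Implicit Type x : 'M[R]_(m, n).

Lemma ler_coord_norm x i j : `|x i j| <= `|x|.
Proof. by rewrite [leRHS]/Num.Def.normr /= mx_normrE; exact: (le_bigmax _ _ (i, j)). Qed.

Lemma ler_norm_coord x (e : R) : 0 <= e -> (forall i j, `|x i j| <= e) -> `|x| <= e.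
Proof.
by move=> e0 xe; rewrite [leLHS]/Num.Def.normr /= mx_normrE; apply: bigmax_le.
Qed.

End MatrixNorm.

(** If F differs from an affine map by a remainder that is quadratic at p, then F is
    differentiable at p and the matrix of the affine map is the jacobian (acting
    on row vectors from the right). *)
Lemma jacobian_quadratic_remainder (R : realType) m n (F : 'rV[R]_m -> 'rV[R]_n)
    (p : 'rV[R]_m) (G : 'M[R]_(m, n)) (K : R) :
  (forall h, `|F (h + p) - (F p + h *m G)| <= K * `|h| ^+ 2) ->
  differentiable F p /\ jacobian F p = G.
Proof.
move=> FG.
have cG : continuous (mulmxr G : 'rV[R]_m -> 'rV[R]_n).
  apply/linear_bounded_continuous/linear_boundedP.
  near=> r => x /=.
  apply: (@le_trans _ _ ((m%:R * `|G|) * `|x|)); last first.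
    by apply: ler_wpM2r => //; near: r; apply: nbhs_pinfty_ge; rewrite num_real.
  apply: ler_norm_coord => [|i j]; first by rewrite !mulr_ge0.
  rewrite mxE; apply: le_trans (ler_norm_sum _ _ _) _.
  rewrite -mulrA mulr_natl -[X in _ *+ X]card_ord -sumr_const; apply: ler_sum => k _.
  by rewrite normrM mulrC ler_pM // ler_coord_norm.
have e1 : F \o shift p = cst (F p) + mulmxr G +o_ (0 : 'rV[R]_m) id.
  apply/eqaddoP => e e0; near=> h.
  apply: (@le_trans _ _ (K * `|h| ^+ 2)).
    exact: FG.
  rewrite expr2 mulrA ler_wpM2r //.
  apply: (@le_trans _ _ ((`|K| + 1) * `|h|)).
    by rewrite ler_wpM2r // (le_trans (ler_norm _)) // lerDl.
  rewrite mulrC -ler_pdivlMr ?ltr_wpDl //.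
  by near: h; rewrite !near_simpl; apply: nbhs0_le; rewrite divr_gt0 // ltr_wpDl.
have dF : 'd F p = mulmxr G :> (_ -> _) by apply: diff_unique.
split; last first.
  apply/row_matrixP => i; rewrite /jacobian !rowE mul_rV_lin1 dF //.
by apply/diff_locallyP; rewrite dF.
Unshelve. all: by end_near. Qed.

Section Coordinates.
Context {R : realType}.

(** The state (L, R, A) as a row vector split as 2 + 1. *)
Definition state (l r a : R) : 'rV[R]_(2 + 1) :=
  row_mx (\row_(i < 2) if i == 0 then l else r) (const_mx a).

(** The coordinates L, R and A of a state. *)
Definition Lc (x : 'rV[R]_(2 + 1)) : R := x 0 (lshift 1 ord0).
Definition Rc (x : 'rV[R]_(2 + 1)) : R := x 0 (lshift 1 ord_max).
Definition Ac (x : 'rV[R]_(2 + 1)) : R := x 0 (rshift 2 ord0).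

Lemma coord_ind (Q : 'I_(2 + 1) -> Prop) :
  Q (lshift 1 ord0) -> Q (lshift 1 ord_max) -> Q (rshift 2 ord0) -> forall i, Q i.
Proof.
move=> QL QR QA i.
rewrite -(fintype.splitK i); case: (fintype.split i) => j /=; last by rewrite (ord1 j).
have [->//|jN] : j = ord0 \/ j = ord_max.
  by case: j => -[|[|//]] hj; [left|right]; apply: val_inj.
by rewrite jN.
Qed.

Lemma stateE l r a : (Lc (state l r a) = l) * (Rc (state l r a) = r) * (Ac (state l r a) = a).
Proof. by rewrite /Lc /Rc /Ac /state !row_mxEl row_mxEr !mxE. Qed.

Lemma state_ext x y : Lc x = Lc y -> Rc x = Rc y -> Ac x = Ac y -> x = y.
Proof. by move=> hl hr ha; apply/rowP; apply: coord_ind. Qed.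

Lemma coordD x y : (Lc (x + y) = Lc x + Lc y) * (Rc (x + y) = Rc x + Rc y) *
  (Ac (x + y) = Ac x + Ac y).
Proof. by rewrite /Lc /Rc /Ac !mxE. Qed.

Lemma coordN x : (Lc (- x) = - Lc x) * (Rc (- x) = - Rc x) * (Ac (- x) = - Ac x).
Proof. by rewrite /Lc /Rc /Ac !mxE. Qed.

Lemma sum_coord (f : 'I_(2 + 1) -> R) :
  \sum_i f i = f (lshift 1 ord0) + f (lshift 1 ord_max) + f (rshift 2 ord0).
Proof. 
rewrite big_split_ord /= !big_ord_recl !big_ord0 !addr0.
by congr (_ + _ + _); congr f; exact: val_inj.
Qed.

Lemma simplexTP x : simplexT x <->
  [/\ 0 <= Lc x, 0 <= Rc x, 0 <= Ac x & Lc x + Rc x + Ac x <= 1].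
Proof.
rewrite /simplexT /= sum_coord; split=> [[x0 x1]|[h1 h2 h3 h4]]; first by split=> //; exact: x0.
by split=> //; exact: coord_ind.
Qed.

Lemma norm_coordP (x : 'rV[R]_(2 + 1)) e : 0 <= e ->
  (`|x| <= e) <-> [/\ `|Lc x| <= e, `|Rc x| <= e & `|Ac x| <= e].
Proof.
move=> e0; split=> [xe|[h1 h2 h3]].
  by split; apply: le_trans xe; exact: ler_coord_norm.
by apply: ler_norm_coord => // i; rewrite (ord1 i); exact: coord_ind.
Qed.

Variable th : param R.

Lemma frozen_fieldE x :
  let C := 1 - Lc x - Rc x - Ac x in
  frozen_field th x = state
    ((C * alphaL th + Ac x * deltaL th - muL th) * Lc x + C * gammaRL th * Rc x)
    (C * gammaLR th * Lc x + (C * alphaR th + Ac x * deltaR th - muR th) * Rc x)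
    (eta th * C - Ac x * (deltaL th * Lc x + deltaR th * Rc x) - rho th * Ac x).
Proof.
rewrite /=.
have CE : Cpart x = 1 - Lc x - Rc x - Ac x.
  rewrite /Cpart /Lc /Rc /Ac /Apart !mxE !big_ord_recl big_ord0 !mxE.
  have -> : lift ord0 ord0 = ord_max :> 'I_2 by apply: val_inj.
  ring.
have vL : vpart x ord0 0 = Lc x by rewrite !mxE.
have vR : vpart x ord_max 0 = Rc x by rewrite !mxE.
have lm : lift ord0 ord0 = ord_max :> 'I_2 by apply: val_inj.
rewrite /frozen_field CE; set C := 1 - _ - _ - _.
have -> : Apart x = Ac x by rewrite /Apart /Ac !mxE.
apply: state_ext; rewrite !stateE /Lc /Rc /Ac ?row_mxEl ?row_mxEr.
- rewrite mxE [LHS]mxE !big_ord_recl big_ord0 lm vL vR !mxE /= -/(Lc x) -/(Rc x) -/(Ac x); ring.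
- rewrite mxE [LHS]mxE !big_ord_recl big_ord0 lm vL vR !mxE /= -/(Lc x) -/(Rc x) -/(Ac x); ring.
- rewrite mxE -/(Lc x) -/(Rc x) -/(Ac x).
  suff -> : (ones^T *m Dmx th *m vpart x) 0 0 = deltaL th * Lc x + deltaR th * Rc x by [].
  rewrite mxE !big_ord_recl big_ord0 lm vL vR !mxE !big_ord_recl !big_ord0 !mxE /=; ring.
Qed.

Lemma EdagE : Edag th = state 0 0 (Adag th).
Proof.
apply: state_ext; rewrite !stateE /Lc /Rc /Ac /Edag ?row_mxEl ?row_mxEr !mxE //.
Qed.

Lemma radical_freeP (x : 'rV[R]_(2 + 1)) : radical_free x <-> Lc x = 0 /\ Rc x = 0.
Proof.
rewrite /radical_free; split=> [h|[h1 h2]].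
  move/matrixP: h => h.
  by move: (h ord0 0) (h ord_max 0); rewrite !mxE.
apply/matrixP => i j; rewrite !mxE (ord1 j).
case: i => -[|[|//]] hi.
  by rewrite -h1; congr (x _ _); apply: val_inj.
by rewrite -h2; congr (x _ _); apply: val_inj.
Qed.

Lemma JradE : Jrad th = mx22
  (Cdag th * alphaL th + Adag th * deltaL th - muL th) (Cdag th * gammaRL th)
  (Cdag th * gammaLR th) (Cdag th * alphaR th + Adag th * deltaR th - muR th).
Proof.
apply/matrixP => i j; rewrite !mxE.
by case: ifP => _; case: ifP => _; rewrite ?mulr0 ?addr0 ?subr0.
Qed.

End Coordinates.

(** * Linearization at the radical-free equilibrium *)

Section Linearization.
Context {R : realType}.
Variable th : param R.
Hypothesis thp : forall i, 0 < th 0 i.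

Lemma param_gt0 :
  ((0 < alphaL th) * (0 < alphaR th) * (0 < gammaLR th) * (0 < gammaRL th)
   * (0 < muL th) * (0 < muR th)) *
  ((0 < deltaL th) * (0 < deltaR th) * (0 < eta th) * (0 < rho th)).
Proof. by do !split; exact: thp. Qed.

Lemma AdagK : (eta th + rho th) * Adag th = eta th.
Proof. by rewrite mulrC divfK // gt_eqF // addr_gt0 // param_gt0. Qed.

Lemma CdagE : Cdag th = rho th / (eta th + rho th).
Proof.
rewrite /Cdag /Adag; field.
by rewrite gt_eqF // addr_gt0 // param_gt0.
Qed.

Lemma Adag_itv : 0 < Adag th < 1.
Proof.
have [h1 h2] : 0 < eta th /\ 0 < rho th by rewrite !param_gt0.
by rewrite divr_gt0 ?addr_gt0 //= ltr_pdivrMr ?addr_gt0 // mul1r ltrDl.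
Qed.

Lemma Cdag_itv : 0 < Cdag th < 1.
Proof. have := Adag_itv; rewrite /Cdag; lra. Qed.

(** The Jacobian matrix at E, with columns indexed by the variables of
    differentiation; the upper right block vanishes since v' is linear in v. *)
Definition frozen_jacobian_mx : 'M[R]_(2 + 1) :=
  block_mx (Jrad th) 0
    (\row_(j < 2) if j == 0 then - (eta th + Adag th * deltaL th)
                  else - (eta th + Adag th * deltaR th))
    (const_mx (- (eta th + rho th))).

(** The field is quadratic, so the remainder of its affine expansion at E is a
    quadratic form, whose coefficients are those of K and D. *)
Lemma frozen_jacobian : differentiable (frozen_field th) (Edag th) /\
  jacobian_mx (frozen_field th) (Edag th) = frozen_jacobian_mx.
Proof.
pose K := alphaL th + alphaR th + gammaLR th + gammaRL th + deltaL th + deltaR th.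
suff [dF jF] : differentiable (frozen_field th) (Edag th) /\
    jacobian (frozen_field th) (Edag th) = frozen_jacobian_mx^T.
  by split=> //; rewrite /jacobian_mx jF trmxK.
apply: (@jacobian_quadratic_remainder _ _ _ _ _ _ (3 * K)) => h.
have K0 : 0 <= K by rewrite /K !addr_ge0 // ltW // param_gt0.
set l := Lc h; set r := Rc h; set a := Ac h.
have -> : frozen_field th (h + Edag th) -
    (frozen_field th (Edag th) + h *m frozen_jacobian_mx^T) =
  state ((- (l + r + a) * alphaL th + a * deltaL th) * l - (l + r + a) * gammaRL th * r)
        (- (l + r + a) * gammaLR th * l + (- (l + r + a) * alphaR th + a * deltaR th) * r)
        (- a * (deltaL th * l + deltaR th * r)).
  have [hE1 hE2 hE3] : [/\ Lc (h + Edag th) = l, Rc (h + Edag th) = r &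
      Ac (h + Edag th) = a + Adag th].
    by rewrite EdagE !coordD !stateE !addr0.
  have hG i : (h *m frozen_jacobian_mx^T) 0 i = l * frozen_jacobian_mx i (lshift 1 ord0) +
      r * frozen_jacobian_mx i (lshift 1 ord_max) + a * frozen_jacobian_mx i (rshift 2 ord0).
    by rewrite mxE sum_coord ![frozen_jacobian_mx^T _ _]mxE.
  rewrite !frozen_fieldE hE1 hE2 hE3 EdagE !stateE.
  apply: state_ext; rewrite !(stateE, coordD, coordN).
  - rewrite /Lc hG /frozen_jacobian_mx !block_mxEul block_mxEur JradE !mxE /= /Cdag; ring.
  - rewrite /Rc hG /frozen_jacobian_mx !block_mxEul block_mxEur JradE !mxE /= /Cdag; ring.
  - rewrite /Ac hG /frozen_jacobian_mx !block_mxEdl block_mxEdr !mxE /=; ring.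
have [hl hr ha] : [/\ `|l| <= `|h|, `|r| <= `|h| & `|a| <= `|h|] by apply/norm_coordP.
set n := `|h| in hl hr ha *.
have n0 : 0 <= n by exact: normr_ge0.
have hp (x y : R) : `|x| <= n -> `|y| <= n -> `|x * y| <= n ^+ 2.
  by move=> hx hy; rewrite normrM expr2 ler_pM.
have h3 (x y : R) : `|x| <= 3 * n -> `|y| <= n -> `|x * y| <= 3 * n ^+ 2.
  by move=> hx hy; rewrite normrM expr2 mulrA ler_pM.
have hs : `|l + r + a| <= 3 * n.
  by apply: le_trans (ler_normD _ _) _; have := ler_normD l r; lra.
have hc (k q x : R) : 0 <= k -> `|x| <= q -> `|k * x| <= k * q.
  by move=> k0 hx; rewrite normrM ger0_norm // ler_wpM2l.
apply/norm_coordP; first by rewrite !mulr_ge0.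
rewrite !stateE.
have [[[[[[a1 a2] a3] a4] _] _] [[[a5 a6] _] _]] := param_gt0.
have n2 : 0 <= n ^+ 2 by exact: sqr_ge0.
move: (hc _ _ _ (ltW a1) (h3 _ _ hs hl)) (hc _ _ _ (ltW a2) (h3 _ _ hs hr))
  (hc _ _ _ (ltW a3) (h3 _ _ hs hl)) (hc _ _ _ (ltW a4) (h3 _ _ hs hr))
  (hc _ _ _ (ltW a5) (hp _ _ ha hl)) (hc _ _ _ (ltW a6) (hp _ _ ha hr)).
rewrite !ler_norml => /andP[b1 c1] /andP[b2 c2] /andP[b3 c3]
  /andP[b4 c4] /andP[b5 c5] /andP[b6 c6].
have q1 := mulr_ge0 (ltW a1) n2; have q2 := mulr_ge0 (ltW a2) n2.
have q3 := mulr_ge0 (ltW a3) n2; have q4 := mulr_ge0 (ltW a4) n2.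
have q5 := mulr_ge0 (ltW a5) n2; have q6 := mulr_ge0 (ltW a6) n2.
rewrite /K; split; apply/andP; split; lra.
Qed.

Lemma spectrum_jacobian (l : R) (z : R[i]) :
  (l - (Cdag th * alphaL th + Adag th * deltaL th - muL th)) *
  (l - (Cdag th * alphaR th + Adag th * deltaR th - muR th)) =
  (Cdag th * gammaRL th) * (Cdag th * gammaLR th) ->
  spectrum (jacobian_mx (frozen_field th) (Edag th)) z <->
  z = real_complex R l \/ z = real_complex R (\tr (Jrad th) - l) \/
  z = real_complex R (- (eta th + rho th)).
Proof.
move=> hl; rewrite frozen_jacobian.2 spectrum_lblock ?block_mxKur //.
rewrite block_mxKul block_mxKdr spectrum11 mxE JradE (spectrum_mx22 _ hl).
have -> : \tr (mx22 (Cdag th * alphaL th + Adag th * deltaL th - muL th) (Cdag th * gammaRL th)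
  (Cdag th * gammaLR th) (Cdag th * alphaR th + Adag th * deltaR th - muR th)) =
  (Cdag th * alphaL th + Adag th * deltaL th - muL th) + 
  (Cdag th * alphaR th + Adag th * deltaR th - muR th).
  by rewrite /mxtrace !big_ord_recl big_ord0 !mxE /= addr0.
tauto.
Qed.

Lemma RLA_mx22 : RLA th = spectral_radius (mx22
  ((Cdag th * alphaL th + Adag th * deltaL th) / muL th) (Cdag th * gammaRL th / muL th)
  (Cdag th * gammaLR th / muR th) ((Cdag th * alphaR th + Adag th * deltaR th) / muR th)).
Proof.
have [m1 m2] : muL th != 0 /\ muR th != 0 by rewrite !gt_eqF ?param_gt0.
rewrite /RLA; congr spectral_radius.
have MV : mx22 (muL th)^-1 0 0 (muR th)^-1 *m Mmx th = 1%:M.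
  apply/matrixP => i j; rewrite !mxE !big_ord_recl big_ord0 !mxE /=.
  by case: i j => -[|[|//]] ? [] [|[|//]] ?; rewrite /= ?mulVf // ?mul0r ?mulr0 ?addr0 ?add0r.
have uM : Mmx th \in unitmx by case/mulmx1_unit: MV.
have -> : invmx (Mmx th) = mx22 (muL th)^-1 0 0 (muR th)^-1.
  by rewrite -[RHS]mulmx1 -(mulmxV uM) mulmxA MV mul1mx.
apply/matrixP => i j; rewrite !mxE !big_ord_recl big_ord0 !mxE /=.
by case: i j => -[|[|//]] ? [] [|[|//]] ?; rewrite /=; ring.
Qed.

(** The dominant eigenvalue [l] of the radical block has the sign of RLA - 1.  The
    products defining RLA and [l] have the same value and positive factors, and
    their factors compare as r mu and l + mu do. *)
Lemma dominant_eigenvalue : exists l : R,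
  [/\ (l - (Cdag th * alphaL th + Adag th * deltaL th - muL th)) *
  (l - (Cdag th * alphaR th + Adag th * deltaR th - muR th)) =
  (Cdag th * gammaRL th) * (Cdag th * gammaLR th),
  Cdag th * alphaL th + Adag th * deltaL th - muL th < l &
  Cdag th * alphaR th + Adag th * deltaR th - muR th < l] /\
  [/\ RLA th < 1 <-> l < 0, RLA th = 1 <-> l = 0 & 1 < RLA th <-> 0 < l].
Proof.
have /andP[A0 _] := Adag_itv; have /andP[C0 _] := Cdag_itv.
have [[[[[[a1 a2] a3] a4] m1] m2] [[[a5 a6] _] _]] := param_gt0.
have n1 : 0 < Cdag th * alphaL th + Adag th * deltaL th by rewrite addr_gt0 // mulr_gt0.
have n2 : 0 < Cdag th * alphaR th + Adag th * deltaR th by rewrite addr_gt0 // mulr_gt0.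
have b0 : 0 < Cdag th * gammaRL th by rewrite mulr_gt0.
have c0 : 0 < Cdag th * gammaLR th by rewrite mulr_gt0.
rewrite RLA_mx22.
move: (Cdag th * alphaL th + Adag th * deltaL th) (Cdag th * alphaR th + Adag th * deltaR th)
  (Cdag th * gammaRL th) (Cdag th * gammaLR th) (muL th) (muR th) m1 m2 n1 n2 b0 c0.
move=> n m b c p q p0 q0 n0 m0 b0 c0.
have [l [hl l1 l2]] := @pf_root_mx22 R (n - p) b c (m - q) (mulr_gt0 b0 c0).
exists l; split=> //.
have bc : 0 < (b / p) * (c / q) by rewrite mulr_gt0 // divr_gt0.
have [r [hr r1 r2]] := @pf_root_mx22 R (n / p) (b / p) (c / q) (m / q) bc.
rewrite (spectral_radius_mx22 _ _ hr r1 r2) ?divr_ge0 ?ltW //.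
rewrite ltr_pdivrMr // in r1; rewrite ltr_pdivrMr // in r2.
have {}hr : (r * p - n) * (r * q - m) = b * c.
  have -> : (r * p - n) * (r * q - m) = ((r - n / p) * (r - m / q)) * (p * q).
    by field; rewrite !gt_eqF.
  by rewrite hr; field; rewrite !gt_eqF.
have h1 : r < 1 -> l < 0.
  move=> h; rewrite ltNge; apply/negP => hl0.
  have e1 : r * p - n < l - (n - p) by nra.
  have e2 : r * q - m < l - (m - q) by nra.
  have : (r * p - n) * (r * q - m) < (l - (n - p)) * (l - (m - q)).
    by rewrite ltr_pM // ?subr_ge0 ltW.
  by rewrite hl hr ltxx.
have h2 : r > 1 -> l > 0.
  move=> h; rewrite ltNge; apply/negP => hl0.
  have e1 : l - (n - p) < r * p - n by nra.
  have e2 : l - (m - q) < r * q - m by nra.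
  have : (l - (n - p)) * (l - (m - q)) < (r * p - n) * (r * q - m).
    by rewrite ltr_pM // ?subr_ge0 ltW.
  by rewrite hl hr ltxx.
have h3 : r = 1 -> l = 0.
  move=> h; rewrite h !mul1r in hr r1 r2.
  have : l * (l - (n - p) + (q - m)) = 0.
    rewrite -(subrr (b * c)) -[X in _ = X - _]hl -hr; ring.
  move/eqP; rewrite mulf_eq0 => /orP[/eqP //|/eqP h0]; lra.
have [hr1|[hr1|hr1]] : r < 1 \/ 1 < r \/ r = 1.
  by case: (ltgtP r 1); [left|right; left|right; right].
- by have hh := h1 hr1; split; split=> h; lra.
- by have hh := h2 hr1; split; split=> h; lra.
- by have hh := h3 hr1; split; split=> h; lra.
Qed.

End Linearization.

(** * Differential inequalities *)

Section Calculus.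
Context {R : realType}.

Lemma is_derive_mxP m n (M : R -> 'M[R]_(m, n)) (t : R) (D : 'M[R]_(m, n)) :
  is_derive t (1 : R) M D <-> forall i j, is_derive t (1 : R) (fun s => M s i j) (D i j).
Proof.
split=> [[dM MD] i j|MD].
  split; first exact: (derivable_mxP _ _ _).1.
  by rewrite -MD derive_mx // mxE.
have dM : derivable M t (1 : R) by apply/derivable_mxP => i j; case: (MD i j).
split=> //; rewrite derive_mx //; apply/matrixP => i j; rewrite mxE.
by case: (MD i j).
Qed.

Lemma is_derive_continuous (V : normedModType R) (f : R -> V) (t : R) (d : V) :
  is_derive t (1 : R) f d -> {for t, continuous f}.
Proof.
by case=> df _; apply: differentiable_continuous; apply/derivable1_diffP.
Qed.

Lemma solution_coord n (F : 'rV[R]_n -> 'rV[R]_n) X x i : is_solution F X x ->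
  {within `[0, +oo[, continuous (fun t => x t 0 i)} /\
  forall t : R, 0 < t -> is_derive t (1 : R) (fun t => x t 0 i) (F (x t) 0 i).
Proof.
case=> cx dx _; split=> [t|t t0]; last by have /is_derive_mxP := dx t t0.
apply: (@continuous_comp _ _ _ (x : subspace _ -> _) (fun M : 'rV[R]_n => M 0 i)).
  exact: cx.
exact: coord_continuous.
Qed.

(** Gronwall's inequality; no sign is assumed on V or k. *)
Lemma gronwall_le (V dV : R -> R) (k : R) :
  {within `[0, +oo[, continuous V} ->
  (forall t : R, 0 < t -> is_derive t (1 : R) V (dV t)) ->
  (forall t, 0 < t -> dV t <= k * V t) ->
  forall t, 0 <= t -> V t <= V 0 * expR (k * t).
Proof.
move=> cV VdV kV t t0.
pose g := fun s => expR (- (k * s)) * V s.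
have de (s : R) : is_derive s (1 : R) (fun t => expR (- (k * t))) (- k * expR (- (k * s))).
  have d1 : is_derive s (1 : R) (fun t => - (k * t)) (- k).
    by apply: is_derive_eq; rewrite /GRing.scale /= mulr1.
  have := @is_derive1_comp _ expR (fun t => - (k * t)) s _ _ (is_derive_expR _) d1.
  by rewrite mulrC.
have dg (s : R) : 0 < s -> is_derive s (1 : R) g (expR (- (k * s)) * (dV s - k * V s)).
  move=> s0; have d1 := de s; have d2 := VdV s s0.
  by have := is_deriveM d1 d2 => /is_derive_eq; apply; rewrite /GRing.scale /=; ring.
have cg : {within `[0, +oo[, continuous g}.
  move=> s; apply: (@continuousM _ (subspace _) (fun t => expR (- (k * t))) V); last exact: cV.
  by apply: continuous_subspaceT => u; apply: is_derive_continuous (de u).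
have := @ler0_derive1_nincry R g 0 _ _ cg 0 t (lexx _) t0.
rewrite /g mulr0 oppr0 expR0 mul1r => gt.
rewrite -ler_pdivrMr ?expR_gt0 // -expRN mulrC; apply: gt => s.
  by rewrite in_itv /= andbT => s0; case: (dg s s0).
rewrite in_itv /= andbT => s0; have [_ E] := dg s s0.
by rewrite derive1E E pmulr_rle0 ?expR_gt0 // subr_le0 kV.
Qed.

(** A sublevel set of V in which V does not increase cannot be left: at the first
    time where V reaches e, V would be at most V 0. *)
Lemma trapping (V dV : R -> R) (e : R) :
  {within `[0, +oo[, continuous V} ->
  (forall t : R, 0 < t -> is_derive t (1 : R) V (dV t)) ->
  (forall t, 0 < t -> V t < e -> dV t <= 0) ->
  V 0 < e -> forall t, 0 <= t -> V t < e.
Proof.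
move=> cV VdV Ve V0 T T0; rewrite ltNge; apply/negP => eT.
pose S := [set t | 0 <= t /\ e <= V t].
have S0 : has_inf S by split; [exists T|exists 0 => t []].
pose t0 := inf S.
have t00 : 0 <= t0 by apply: lb_le_inf S0.1 _ => t [].
(* t0 is the first exit time *)
have below t : 0 <= t -> t < t0 -> V t < e.
  move=> tge0 tt0; rewrite ltNge; apply/negP => et.
  by have := ge_inf S0.2 (conj tge0 et); rewrite leNgt tt0.
have et0 : e <= V t0.
  rewrite leNgt; apply/negP => Vt0.
  have [d /= d0 hd] : \forall s \near t0, 0 <= s -> V s < e.
    have A0 : `[0, +oo[%classic t0 by rewrite /= in_itv /= t00.
    have := (subspace_continuousP _ _).1 cV t0 A0.
    move=> /cvgr_lt /(_ _ Vt0); rewrite near_withinE.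
    by apply: filterS => s h s0; apply: h; rewrite /= in_itv /= s0.
  have [s [s0 es] st] := inf_adherent d0 S0.
  have ts := ge_inf S0.2 (conj s0 es : S s); rewrite -/t0 in ts.
  have : V s < e.
    by apply: hd => //; rewrite /ball /= distrC ger0_norm ?subr_ge0 // ltrBlDl.
  by rewrite ltNge es.
suff : V t0 <= V 0 by rewrite leNgt (lt_le_trans V0 et0).
have cV' : {within `[0, t0], continuous V}.
  by apply: continuous_subspaceW cV => s /=; rewrite !in_itv /= => /andP[->].
apply: (ler0_derive1_le_cc _ _ cV') => //; rewrite ?in_itv /= ?lexx ?t00 //.
  by move=> s; rewrite in_itv /= => /andP[s0 _]; case: (VdV s s0).
move=> s; rewrite in_itv /= => /andP[s0 st]; have [_ E] := VdV s s0.
by rewrite derive1E E Ve // below // ltW.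
Qed.

End Calculus.

(** * Existence of solutions *)

Section Existence.
Context {R : realType}.
Variable th : param R.
Hypothesis thp : forall i, 0 < th 0 i.

(** The model as a gain-loss system on the species 0 = L, 1 = R, 2 = A, 3 = C.
    [reaction_rate i k j] is the rate of conversion of i into k per particle j;
    spontaneous conversions do not depend on j, since the total mass is 1. *)
Definition reaction_rate (i k j : 'I_4) : R :=
  match nat_of_ord i, nat_of_ord k, nat_of_ord j with
  | 3, 0, 0 => alphaL th | 3, 0, 1 => gammaRL th
  | 3, 1, 0 => gammaLR th | 3, 1, 1 => alphaR th
  | 2, 0, 0 => deltaL th | 2, 1, 1 => deltaR th
  | 0, 3, _ => muL th | 1, 3, _ => muR th
  | 3, 2, _ => eta th | 2, 3, _ => rho th
  | _, _, _ => 0%R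
  end%N.

Lemma reaction_rate_ge0 i k j : 0 <= reaction_rate i k j.
Proof.
rewrite /reaction_rate.
by case: i k j => -[|[|[|[|//]]]] ? [] [|[|[|[|//]]]] ? [] [|[|[|[|//]]]] ? /=;
  rewrite // ltW //; exact: thp.
Qed.

Lemma is_derive_state (l r a : R -> R) (t dl dr da : R) :
  is_derive t (1 : R) l dl -> is_derive t (1 : R) r dr -> is_derive t (1 : R) a da ->
  is_derive t (1 : R) (fun s => state (l s) (r s) (a s)) (state dl dr da).
Proof.
move=> hl hr ha; apply/is_derive_mxP => i; rewrite (ord1 i); apply: coord_ind.
- rewrite (_ : (fun s => _) = l); last by apply/funext => s; exact: (stateE _ _ _).1.1.
  by rewrite [state _ _ _ _ _](stateE dl dr da).1.1.
- rewrite (_ : (fun s => _) = r); last by apply/funext => s; exact: (stateE _ _ _).1.2.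
  by rewrite [state _ _ _ _ _](stateE dl dr da).1.2.
- rewrite (_ : (fun s => _) = a); last by apply/funext => s; exact: (stateE _ _ _).2.
  by rewrite [state _ _ _ _ _](stateE dl dr da).2.
Qed.

Lemma big_ord4 (f : 'I_4 -> R) : \sum_i f i =
  f (inord 0) + f (inord 1) + f (inord 2) + f (inord 3).
Proof.
rewrite !big_ord_recl big_ord0 addr0 !addrA.
by congr (f _ + f _ + f _ + f _); apply: val_inj; rewrite /= inordK.
Qed.

(** Every point of the simplex is the initial value of a global solution that stays
    in the simplex. *)
Lemma frozen_solution p : simplexT p ->
  exists2 x, is_solution (frozen_field th) simplexT x & x 0 = p.
Proof.
move/simplexTP => [p1 p2 p3 p4].
pose x0 (i : 'I_4) : R := match nat_of_ord i with
  0 => Lc p | 1 => Rc p | 2 => Ac p | _ => (1 - (Lc p + Rc p + Ac p))%R end%N.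
have x00 i : 0 <= x0 i.
  by rewrite /x0; case: i => -[|[|[|[|//]]]] ? //=; rewrite subr_ge0.
have x01 : \sum_i x0 i = 1.
  by rewrite big_ord4 /x0 !inordK //=; ring.
pose X := wild_sum reaction_rate x0.
pose x t := state (X t (inord 0)) (X t (inord 1)) (X t (inord 2)).
have Xs t : 0 <= t -> X t (inord 3) = 1 - X t (inord 0) - X t (inord 1) - X t (inord 2).
  move=> t0; rewrite -(wild_sum_sum reaction_rate_ge0 x00 x01 t0) big_ord4 -/(X t); ring.
have dx (t : R) : 0 <= t -> is_derive t (1 : R) x (frozen_field th (x t)).
  move=> t0; rewrite frozen_fieldE !stateE -Xs //.
  have dX k := is_derive_wild_sum reaction_rate_ge0 x00 x01 k t0.
  have X1 : X t (inord 0) + X t (inord 1) + X t (inord 2) + X t (inord 3) = 1.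
    by rewrite -(wild_sum_sum reaction_rate_ge0 x00 x01 t0) big_ord4.
  apply: is_derive_state; [have := dX (inord 0)|have := dX (inord 1)|have := dX (inord 2)];
    move/is_derive_eq; apply; rewrite -/X !big_ord4 /reaction_rate !inordK //=;
    move: X1; rewrite -/(X t) -/X;
    move: (X t (inord 0)) (X t (inord 1)) (X t (inord 2)) (X t (inord 3)) => l r a c X1;
    (have -> : l = 1 - r - a - c by rewrite -X1; ring); ring.
exists x; last first.
  by apply: state_ext; rewrite /x !stateE /X wild_sum0 /x0 inordK.
split=> [|t /ltW|t t0].
- apply: continuous_in_subspaceT => t; rewrite inE /= in_itv /= andbT => t0.
  exact: is_derive_continuous (dx t t0).
- exact: dx.
- have X0 k : 0 <= X t k by exact: (wild_sum_ge0 reaction_rate_ge0 x00 x01).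
  apply/simplexTP; rewrite !stateE; split=> //.
  have := Xs t t0; have := X0 (inord 3); lra.
Qed.

End Existence.

(** * Nonlinear stability and instability *)

(** In this section [l] is the dominant eigenvalue of the radical block. *)
Section Dynamics.
Context {R : realType}.
Variable th : param R.
Hypothesis thp : forall i, 0 < th 0 i.
Variable l : R.
Local Notation J11 := (Cdag th * alphaL th + Adag th * deltaL th - muL th).
Local Notation J22 := (Cdag th * alphaR th + Adag th * deltaR th - muR th).
Hypothesis hl : (l - J11) * (l - J22) = (Cdag th * gammaRL th) * (Cdag th * gammaLR th).
Hypothesis l1 : J11 < l.

(** [(wL, wR)] is a positive left eigenvector of the radical block for [l]. *)
Definition wL : R := Cdag th * gammaLR th.
Definition wR : R := l - J11.

Lemma wL_gt0 : 0 < wL.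
Proof. by have /andP[C0 _] := Cdag_itv thp; rewrite mulr_gt0 // param_gt0. Qed.

Lemma wR_gt0 : 0 < wR. Proof. by rewrite subr_gt0. Qed.

(** The radical mass w . v. *)
Definition radical_mass (x : 'rV[R]_(2 + 1)) : R := wL * Lc x + wR * Rc x.

(** The deviation of A from its value at E. *)
Definition autocatalyst_dev (x : 'rV[R]_(2 + 1)) : R := Ac x - Adag th.

(** The change in the derivative of the radical mass at (L, R) = (u, v) when C
    decreases by s and A increases by a from their values at E. *)
Definition defect (u v s a : R) : R :=
  wL * ((deltaL th * a - alphaL th * s) * u - gammaRL th * s * v) +
  wR * ((deltaR th * a - alphaR th * s) * v - gammaLR th * s * u).

Lemma field_mass x : radical_mass (frozen_field th x) =
  l * radical_mass x +
  defect (Lc x) (Rc x) (Lc x + Rc x + autocatalyst_dev x) (autocatalyst_dev x).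
Proof.
rewrite /radical_mass frozen_fieldE !stateE /defect /autocatalyst_dev.
set a := Ac x - Adag th.
have -> : Ac x = Adag th + a by rewrite /a; ring.
have eqR : wL * (Cdag th * gammaRL th) + wR * J22 = l * wR.
  by rewrite /wL mulrC -hl /wR; ring.
have -> : l * (wL * Lc x + wR * Rc x) =
   (wL * J11 + wR * (Cdag th * gammaLR th)) * Lc x +
   (wL * (Cdag th * gammaRL th) + wR * J22) * Rc x.
  by rewrite eqR /wL /wR; ring.
rewrite /Cdag; ring.
Qed.

Lemma field_dev x : Ac (frozen_field th x) =
  - (eta th + rho th) * autocatalyst_dev x -
  (eta th * (Lc x + Rc x) + Ac x * (deltaL th * Lc x + deltaR th * Rc x)).
Proof.
rewrite frozen_fieldE stateE /autocatalyst_dev.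
have -> : - (eta th + rho th) * (Ac x - Adag th) =
  - (eta th + rho th) * Ac x + (eta th + rho th) * Adag th by ring.
rewrite AdagK //; ring.
Qed.

(** A bound for the size of the defect, per unit of radical mass and of the
    perturbation (s, a). *)
Definition defect_rate : R := alphaL th + deltaL th + alphaR th + deltaR th +
  gammaRL th * (wL / wR) + gammaLR th * (wR / wL).

Lemma defect_rate_gt0 : 0 < defect_rate.
Proof.
have p := wL_gt0; have q := wR_gt0.
have [[[[[[a1 a2] a3] a4] _] _] [[[a5 a6] _] _]] := param_gt0 thp.
by rewrite /defect_rate !addr_gt0 // mulr_gt0 // divr_gt0.
Qed.

(** A one-sided bound; applied to (-s, -a), it bounds the defect from below. *)
Lemma defect_le u v s a n : 0 <= u -> 0 <= v -> 0 <= n -> - s <= n -> a <= n ->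
  defect u v s a <= n * defect_rate * (wL * u + wR * v).
Proof.
move=> u0 v0 n0 sn an.
have p := wL_gt0; have q := wR_gt0.
have [[[[[[a1 a2] a3] a4] _] _] [[[a5 a6] _] _]] := param_gt0 thp.
rewrite /defect_rate /defect.
have h (k y z : R) : 0 <= k -> y <= n -> 0 <= z -> k * y * z <= k * n * z.
  by move=> k0 yn z0; rewrite ler_wpM2r // ler_wpM2l.
set b1 := wL * u; set b2 := wR * v.
have b10 : 0 <= b1 by rewrite mulr_ge0 // ltW.
have b20 : 0 <= b2 by rewrite mulr_ge0 // ltW.
have c10 : 0 <= wL / wR * b2 by rewrite mulr_ge0 // divr_ge0 // ltW.
have c20 : 0 <= wR / wL * b1 by rewrite mulr_ge0 // divr_ge0 // ltW.
have -> : wL * ((deltaL th * a - alphaL th * s) * u - gammaRL th * s * v) +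
  wR * ((deltaR th * a - alphaR th * s) * v - gammaLR th * s * u) =
  (deltaL th * a * b1 + alphaL th * (- s) * b1 + gammaRL th * (- s) * (wL / wR * b2)) +
  (deltaR th * a * b2 + alphaR th * (- s) * b2 + gammaLR th * (- s) * (wR / wL * b1)).
  by rewrite /b1 /b2; field; rewrite !gt_eqF.
have z1 := mulr_ge0 n0 b10. have z2 := mulr_ge0 n0 b20.
have z3 : 0 <= n * (wL / wR * b1) by rewrite mulr_ge0 // mulr_ge0 // divr_ge0 // ltW.
have z4 : 0 <= n * (wR / wL * b2) by rewrite mulr_ge0 // mulr_ge0 // divr_ge0 // ltW.
have -> : n * (alphaL th + deltaL th + alphaR th + deltaR th +
  gammaRL th * (wL / wR) + gammaLR th * (wR / wL)) * (b1 + b2) =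
  (deltaL th * n * b1 + alphaL th * n * b1 + gammaRL th * n * (wL / wR * b2)) +
  (deltaR th * n * b2 + alphaR th * n * b2 + gammaLR th * n * (wR / wL * b1)) +
  (deltaL th * (n * b2) + alphaL th * (n * b2) + gammaRL th * (n * (wL / wR * b1))) +
  (deltaR th * (n * b1) + alphaR th * (n * b1) + gammaLR th * (n * (wR / wL * b2))) by ring.
rewrite -[leRHS]addrA ler_wpDr //.
  by rewrite !addr_ge0 // mulr_ge0 // ?mulr_ge0 // ltW.
by rewrite !lerD // h // ltW.
Qed.

Lemma radical_mass_ge0 x : simplexT x -> 0 <= radical_mass x.
Proof.
move/simplexTP=> [x1 x2 _ _].
by rewrite addr_ge0 // mulr_ge0 // ltW // ?wL_gt0 // wR_gt0.
Qed.

Lemma solution_mass x : is_solution (frozen_field th) simplexT x ->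
  {within `[0, +oo[, continuous (radical_mass \o x)} /\
  forall t : R, 0 < t -> is_derive t (1 : R) (radical_mass \o x)
    (radical_mass (frozen_field th (x t))).
Proof.
move=> sx.
have [cL dL] := solution_coord (lshift 1 ord0) sx.
have [cR dR] := solution_coord (lshift 1 ord_max) sx.
split=> [t|t t0].
  pose fL := fun s : subspace `[0, +oo[ => x s 0 (lshift 1 ord0).
  pose fR := fun s : subspace `[0, +oo[ => x s 0 (lshift 1 ord_max).
  apply: (@continuousD _ _ _ (fun s => wL * fL s) (fun s => wR * fR s)).
    by apply: (@continuousM _ _ (cst wL) fL); [exact: cst_continuous|exact: cL].
  by apply: (@continuousM _ _ (cst wR) fR); [exact: cst_continuous|exact: cR].
have d1 := dL t t0; have d2 := dR t t0.
rewrite /comp /radical_mass /Lc /Rc.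
by apply: is_derive_eq.
Qed.

Lemma solution_dev x : is_solution (frozen_field th) simplexT x ->
  {within `[0, +oo[, continuous (autocatalyst_dev \o x)} /\
  forall t : R, 0 < t -> is_derive t (1 : R) (autocatalyst_dev \o x)
    (Ac (frozen_field th (x t))).
Proof.
move=> sx.
have [cA dA] := solution_coord (rshift 2 ord0) sx.
split=> [t|t t0].
  pose fA := fun s : subspace `[0, +oo[ => x s 0 (rshift 2 ord0).
  by apply: (@continuousB _ _ _ fA (cst (Adag th))); [exact: cA|exact: cst_continuous].
have d1 := dA t t0.
rewrite /comp /autocatalyst_dev /Ac.
by apply: is_derive_eq; rewrite subr0.
Qed.

(** The Lyapunov function. *)
Definition lyap x : R := autocatalyst_dev x ^+ 2 + radical_mass x.

Lemma lyap_ge0 x : simplexT x -> 0 <= lyap x.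
Proof. by move=> xT; rewrite addr_ge0 ?sqr_ge0 ?radical_mass_ge0. Qed.

Lemma solution_lyap x : is_solution (frozen_field th) simplexT x ->
  {within `[0, +oo[, continuous (lyap \o x)} /\
  forall t : R, 0 < t -> is_derive t (1 : R) (lyap \o x)
   (2 * autocatalyst_dev (x t) * Ac (frozen_field th (x t)) +
    radical_mass (frozen_field th (x t))).
Proof.
move=> sx.
have [cm dm] := solution_mass sx; have [ca da] := solution_dev sx.
split=> [t|t t0].
  pose fa := fun s : subspace `[0, +oo[ => autocatalyst_dev (x s).
  pose fm := fun s : subspace `[0, +oo[ => radical_mass (x s).
  apply: (@continuousD _ _ _ (fun s => fa s * fa s) fm); last exact: cm.
  by apply: (@continuousM _ _ fa fa); exact: ca.
have d1 := dm t t0; have d2 := da t t0.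
rewrite (_ : lyap \o x =
  (autocatalyst_dev \o x) * (autocatalyst_dev \o x) + (radical_mass \o x)) //.
apply: is_derive_eq; rewrite /GRing.scale /=; ring.
Qed.

Lemma lyap_close e : 0 < e -> exists2 d : R, 0 < d &
  forall x, simplexT x -> lyap x < d -> `|x - Edag th| < e.
Proof.
move=> e0; have p := wL_gt0; have q := wR_gt0.
pose h := e / 2.
have h0 : 0 < h by rewrite divr_gt0.
exists (Num.min (h ^+ 2) (Num.min (wL * h) (wR * h))).
  by rewrite !lt_min exprn_gt0 //= (mulr_gt0 p) // (mulr_gt0 q).
move=> x xT; rewrite !lt_min /lyap /radical_mass => /andP[g1 /andP[g2 g3]].
have /simplexTP[x1 x2 x3 x4] := xT.
have y1 := mulr_ge0 (ltW p) x1; have y2 := mulr_ge0 (ltW q) x2.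
have y3 := sqr_ge0 (autocatalyst_dev x).
apply: (@le_lt_trans _ _ h); last by rewrite /h; lra.
apply/norm_coordP; first exact: ltW.
rewrite EdagE !(coordD, coordN) !stateE !subr0 (ger0_norm x1) (ger0_norm x2); split.
- by rewrite -(ler_pM2l p); lra.
- by rewrite -(ler_pM2l q); lra.
- rewrite -/(autocatalyst_dev x) -ler_sqr ?nnegrE ?(ltW h0) // real_normK ?num_real //; lra.
Qed.

Lemma lyap_small e : 0 < e -> exists2 d : R, 0 < d &
  forall x, simplexT x -> `|x - Edag th| < d -> lyap x < e.
Proof.
move=> e0; have p := wL_gt0; have q := wR_gt0.
have s0 : 0 < 1 + wL + wR by lra.
exists (Num.min 1 (e / (1 + wL + wR))); first by rewrite lt_min ltr01 divr_gt0.
move=> x xT; rewrite lt_min ltr_pdivlMr // => /andP[n1 ne].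
set n := `|x - Edag th| in n1 ne.
have n0 : 0 <= n by exact: normr_ge0.
have /(norm_coordP _ n0) : `|x - Edag th| <= n by [].
have /simplexTP[x1 x2 x3 x4] := xT.
rewrite EdagE !(coordD, coordN) !stateE !subr0 -/(autocatalyst_dev x).
move=> [h1 h2 h3]; rewrite !ger0_norm // in h1 h2.
have h4 : autocatalyst_dev x ^+ 2 <= n.
  rewrite -real_normK ?num_real // expr2 -[leRHS]mulr1 ler_pM //.
  exact: le_trans h3 (ltW n1).
have h5 := ler_wpM2l (ltW p) h1; have h6 := ler_wpM2l (ltW q) h2.
rewrite /lyap /radical_mass; lra.
Qed.

(** A bound, relative to the radical mass, for the rate at which radicals slow the
    growth of A, by consuming A or by lowering C. *)
Definition forcing_rate : R := (eta th + deltaL th + deltaR th) * (wL^-1 + wR^-1).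

Lemma forcing_le x : simplexT x ->
  0 <= eta th * (Lc x + Rc x) + Ac x * (deltaL th * Lc x + deltaR th * Rc x) <=
  forcing_rate * radical_mass x.
Proof.
move=> /simplexTP[x1 x2 x3 x4].
have p := wL_gt0; have q := wR_gt0.
have [_ [[[a5 a6] a7] _]] := param_gt0 thp.
apply/andP; split.
  by rewrite addr_ge0 ?mulr_ge0 ?addr_ge0 ?mulr_ge0 // ltW.
apply: (@le_trans _ _ ((eta th + deltaL th + deltaR th) * (Lc x + Rc x))).
  have y1 : deltaL th * Lc x <= deltaL th * (Lc x + Rc x) by rewrite ler_pM2l // lerDl.
  have y2 : deltaR th * Rc x <= deltaR th * (Lc x + Rc x) by rewrite ler_pM2l // lerDr.
  have z1 : 0 <= deltaL th * Lc x + deltaR th * Rc x by rewrite addr_ge0 ?mulr_ge0 // ltW.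
  have y3 : Ac x * (deltaL th * Lc x + deltaR th * Rc x) <= deltaL th * Lc x + deltaR th * Rc x.
    by rewrite -[leRHS]mul1r ler_wpM2r //; lra.
  lra.
rewrite /forcing_rate /radical_mass -mulrA ler_pM2l ?addr_gt0 //.
have -> : (wL^-1 + wR^-1) * (wL * Lc x + wR * Rc x) =
   Lc x + Rc x + (wL / wR * Lc x + wR / wL * Rc x) by field; rewrite !gt_eqF.
by rewrite lerDl addr_ge0 // mulr_ge0 // divr_ge0 // ltW.
Qed.

Lemma forcing_rate_gt0 : 0 < forcing_rate.
Proof.
have p := wL_gt0; have q := wR_gt0.
have [_ [[[a5 a6] a7] _]] := param_gt0 thp.
by rewrite mulr_gt0 // !addr_gt0 ?invr_gt0.
Qed.

Lemma lyap_decrease : l < 0 -> exists k e : R, [/\ 0 < k, 0 < e &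
  forall x, simplexT x -> lyap x < e ->
   2 * autocatalyst_dev x * Ac (frozen_field th x) + radical_mass (frozen_field th x)
   <= - k * lyap x].
Proof.
move=> l0.
have k0 := defect_rate_gt0; have m0 := forcing_rate_gt0.
have [_ [[_ e0] r0]] := param_gt0 thp.
(* for |a| < n the terms of order |a| W use up at most half of the decay rate -l *)
pose n := - l / 2 / (defect_rate + 2 * forcing_rate).
have n0 : 0 < n by rewrite !divr_gt0 ?oppr_gt0 // addr_gt0 // mulr_gt0.
have nE : n * (defect_rate + 2 * forcing_rate) = - l / 2.
  by rewrite divfK // gt_eqF // addr_gt0 // mulr_gt0.
exists (Num.min (2 * (eta th + rho th)) (- l / 2)), (n ^+ 2); split.
- by rewrite lt_min !mulr_gt0 ?addr_gt0 // oppr_gt0.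
- by rewrite exprn_gt0.
move=> x xT; rewrite /lyap.
have W0 := radical_mass_ge0 xT.
set k := Num.min _ _.
have kr : k <= 2 * (eta th + rho th) by rewrite ge_min lexx.
have kl : k <= - l / 2 by rewrite ge_min lexx orbT.
rewrite field_mass field_dev.
have /andP[f0 fm] := forcing_le xT.
have /simplexTP[x1 x2 x3 x4] := xT.
set f := eta th * _ + _ in f0 fm *.
set a := autocatalyst_dev x; set W := radical_mass x in W0 fm *.
move=> an2.
have a2 : a ^+ 2 < n ^+ 2 by lra.
have an : `|a| < n by rewrite -ltr_sqr ?nnegrE // ?(ltW n0) // real_normK ?num_real.
move: an; rewrite ltr_norml => /andP[an1 an3].
have dl : defect (Lc x) (Rc x) (Lc x + Rc x + a) a <= n * defect_rate * W.
  by apply: defect_le => //; lra.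
have h1 : - a * f <= n * (forcing_rate * W).
  apply: (@le_trans _ _ (n * f)); first by rewrite ler_wpM2r //; lra.
  by rewrite ler_pM2l.
have h2 : n * defect_rate * W + 2 * (n * (forcing_rate * W)) = - l / 2 * W.
  by rewrite -nE; ring.
have h3 : k * a ^+ 2 <= 2 * (eta th + rho th) * a ^+ 2 by rewrite ler_wpM2r // sqr_ge0.
have h4 : k * W <= - l / 2 * W by rewrite ler_wpM2r.
have -> : 2 * a * (- (eta th + rho th) * a - f) =
  - (2 * (eta th + rho th) * a ^+ 2) + 2 * (- a * f) by ring.
lra.
Qed.

Lemma cvg_expR_decay (k : R) : 0 < k -> expR (- k * t) @[t --> +oo] --> 0.
Proof.
move=> k0; under eq_fun do rewrite mulNr.
apply: (@cvg_comp _ _ _ (fun t => k * t) (fun t => expR (- t))); last exact: cvgr_expR.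
exact: gt0_cvgMry.
Qed.

Lemma dominant_neg_stable : l < 0 ->
  locally_asymptotically_stable (frozen_field th) simplexT (Edag th).
Proof.
move=> /lyap_decrease[k [e1 [k0 e10 dec]]].
have decay x e : is_solution (frozen_field th) simplexT x -> e <= e1 -> lyap (x 0) < e ->
   forall t : R, 0 <= t -> lyap (x t) < e /\ lyap (x t) <= lyap (x 0) * expR (- k * t).
  move=> sx ee1 x0e; have [cV dV] := solution_lyap sx; have [_ _ xT] := sx.
  have small t : 0 <= t -> lyap (x t) < e.
    apply: (trapping cV dV) => // s s0 se.
    apply: (le_trans (dec _ (xT s (ltW s0)) (lt_le_trans se ee1))).
    rewrite mulNr oppr_le0 mulr_ge0 ?(ltW k0) //.
    by apply: lyap_ge0; apply: xT; apply: ltW.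
  move=> t t0; split; first exact: small.
  apply: (gronwall_le cV dV) => // s s0; apply: dec; first exact/xT/ltW.
  by apply: lt_le_trans ee1; apply: small; apply: ltW.
split=> [e e0|].
  have [e2 e20 close] := lyap_close e0.
  have em : 0 < Num.min e1 e2 by rewrite lt_min e10.
  have [d d0 sm] := lyap_small em.
  exists d => // x sx xd t t0; have [_ _ xT] := sx.
  apply: close; first exact: xT.
  have := (decay x _ sx _ (sm _ (xT 0 (lexx _)) xd) t t0).1.
  by rewrite lt_min ge_min lexx => /(_ isT) /andP[].
have [d d0 sm] := lyap_small e10.
exists d => // x sx xd; have [_ _ xT] := sx.
have := decay x _ sx (lexx _) (sm _ (xT 0 (lexx _)) xd) => dx.
apply/cvgrPdist_lt => e e0; have [e2 e20 close] := lyap_close e0.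
have cE : lyap (x 0) * expR (- k * t) @[t --> +oo] --> lyap (x 0) * 0.
  apply: cvgM; first exact: cvg_cst.
  exact: cvg_expR_decay.
rewrite mulr0 in cE; move/cvgr_lt : cE => /(_ _ e20) cE.
near=> t; rewrite distrC; apply: close; first by apply: xT; near: t; exact: nbhs_pinfty_ge.
apply: (@le_lt_trans _ _ (lyap (x 0) * expR (- k * t))); last by near: t.
by apply: (dx t _).2; near: t; exact: nbhs_pinfty_ge.
Unshelve. all: by end_near. Qed.

Lemma dominant_pos_unstable : 0 < l -> unstable (frozen_field th) simplexT (Edag th).
Proof.
move=> l0 stable.
have p := wL_gt0; have q := wR_gt0; have k0 := defect_rate_gt0.
have /andP[C0 _] := Cdag_itv thp; have /andP[A0 _] := Adag_itv thp.
(* |L|, |R|, |a| <= e make the decrease L + R + a of C at most 3 e in size, which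
   costs at most half of the growth rate l *)
pose e := l / 2 / defect_rate / 3.
have e0 : 0 < e by rewrite divr_gt0 // divr_gt0 // divr_gt0.
have eE : 3 * e * defect_rate = l / 2 by rewrite /e; field; rewrite gt_eqF.
have [d d0 near_E] := stable e e0.
pose h := Num.min (d / 2) (Cdag th).
have h0 : 0 < h by rewrite lt_min divr_gt0.
have hd : h < d by rewrite gt_min; apply/orP; left; lra.
have hC : h <= Cdag th by rewrite ge_min lexx orbT.
pose x0 := state h 0 (Adag th).
have x0T : simplexT x0.
  apply/simplexTP; rewrite /x0 !stateE; split => //; rewrite ?(ltW h0) ?(ltW A0) //.
  by move: hC; rewrite /Cdag; lra.
have [x sx x0E] := frozen_solution thp x0T.
have x0d : `|x 0 - Edag th| < d.
  apply: le_lt_trans hd; apply/norm_coordP; first exact: ltW.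
  rewrite x0E EdagE /x0 !(coordD, coordN) !stateE !subrr !subr0 normr0.
  by rewrite (ger0_norm (ltW h0)) lexx (ltW h0).
have close t : 0 <= t -> `|x t - Edag th| <= e by move=> t0; apply/ltW/near_E.
have [_ _ xT] := sx.
have [cm dm] := solution_mass sx.
have grow t : 0 < t -> l / 2 * radical_mass (x t) <= radical_mass (frozen_field th (x t)).
  move=> t0; rewrite field_mass.
  have tT := xT t (ltW t0).
  have /simplexTP[x1 x2 x3 x4] := tT.
  have W0 := radical_mass_ge0 tT.
  have /(norm_coordP _ (ltW e0)) := close t (ltW t0).
  rewrite EdagE !(coordD, coordN) !stateE !subr0 -/(autocatalyst_dev _) !ler_norml.
  set a := autocatalyst_dev _; move=> [/andP[_ b1] /andP[_ b2] /andP[b3 b4]].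
  have e3 : 0 <= 3 * e by rewrite mulr_ge0 // ltW.
  have := @defect_le (Lc (x t)) (Rc (x t))
    (- (Lc (x t) + Rc (x t) + a)) (- a) (3 * e) x1 x2 e3.
  rewrite eE -/(radical_mass _).
  have -> : defect (Lc (x t)) (Rc (x t)) (- (Lc (x t) + Rc (x t) + a)) (- a) =
    - defect (Lc (x t)) (Rc (x t)) (Lc (x t) + Rc (x t) + a) a by rewrite /defect; ring.
  by move=> h1; have := h1 _ _; lra.
pose V := fun t => - radical_mass (x t).
have VT : forall t, 0 <= t -> V t <= V 0 * expR (l / 2 * t).
  apply: (@gronwall_le _ V (fun t => - radical_mass (frozen_field th (x t)))).
  - move=> t; apply: (@continuousN _ _ _ (radical_mass \o x : subspace _ -> _)); exact: cm.
  - by move=> t t0; have d1 := dm t t0; apply: is_deriveN.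
  - by move=> t t0; rewrite /V mulrN lerN2 grow.
have W0 : radical_mass (x 0) = wL * h.
  by rewrite x0E /radical_mass /x0 !stateE mulr0 addr0.
have wh : 0 < wL * h by rewrite (mulr_gt0 p).
(* by time T the lower bound for W exceeds wL + wR, its bound on the simplex *)
pose T := (wL + wR) / (wL * h) / (l / 2).
have T0 : 0 <= T by rewrite ltW // divr_gt0 // divr_gt0 //; lra.
have := VT T T0; rewrite /V W0 mulNr lerN2.
have lT : l / 2 * T = (wL + wR) / (wL * h) by rewrite /T; field; rewrite !gt_eqF.
rewrite lT => WT.
have E1 : wL * h * (1 + (wL + wR) / (wL * h)) <= wL * h * expR ((wL + wR) / (wL * h)).
  by rewrite (ler_pM2l wh) expR_ge1Dx.
have E2 : wL * h * (1 + (wL + wR) / (wL * h)) = wL * h + (wL + wR).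
  by field; rewrite !gt_eqF.
have /simplexTP[x1 x2 x3 x4] := xT T T0.
have u1 : wL * Lc (x T) <= wL by rewrite -[leRHS]mulr1 (ler_pM2l p); lra.
have u2 : wR * Rc (x T) <= wR by rewrite -[leRHS]mulr1 (ler_pM2l q); lra.
move: WT; rewrite /radical_mass; lra.
Qed.

End Dynamics.

(** * The equilibrium and its stability type *)

Section Equilibrium.
Context {R : realType}.
Variable th : param R.
Hypothesis thp : forall i, 0 < th 0 i.

Lemma Edag_simplex : simplexT (Edag th).
Proof.
have /andP[A0 A1] := Adag_itv thp.
by apply/simplexTP; rewrite EdagE !stateE !add0r; split=> //; apply: ltW.
Qed.

Lemma Edag_radical_free : radical_free (Edag th).
Proof. by apply/radical_freeP; rewrite EdagE !stateE. Qed.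

Lemma Edag_equilibrium : is_equilibrium (frozen_field th) (Edag th).
Proof.
have eD := AdagK thp.
rewrite /is_equilibrium frozen_fieldE EdagE !stateE.
apply: state_ext; rewrite !stateE [RHS]mxE ?(mulr0, addr0, subr0) //.
by rewrite mulrBr mulr1 -addrA -opprD -mulrDl eD subrr.
Qed.

Lemma radical_free_equilibrium_unique x :
  radical_free x -> is_equilibrium (frozen_field th) x -> x = Edag th.
Proof.
move=> /radical_freeP[xL xR] /(congr1 Ac).
rewrite frozen_fieldE !stateE /Ac [RHS]mxE -/(Ac x) xL xR => xA.
apply: state_ext; rewrite EdagE !stateE //.
have s0 : eta th + rho th != 0 by rewrite gt_eqF // addr_gt0 //; exact: thp.
apply: (mulfI s0); rewrite AdagK //; lra.
Qed.

End Equilibrium.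

Theorem theorem2p3 (R : realType) (P : set (param R))
    (Pcompact : compact P) (Pconvex : convex_set P)
    (Ppos : forall th, P th -> forall i, 0 < th 0 i)
    (th : param R) (Pth : P th) :
  let F := frozen_field th in
  let E := Edag th in
  [/\ simplexT E /\ radical_free E /\ is_equilibrium F E,
      forall x, radical_free x -> is_equilibrium F x -> x = E,
      0 < Adag th < 1,
      Cdag th = rho th / (eta th + rho th) &
      0 < Cdag th < 1] /\
  [/\ differentiable F E,
      ursubmx (jacobian_mx F E : 'M[R]_(2 + 1)) = 0 &
      ulsubmx (jacobian_mx F E : 'M[R]_(2 + 1)) = Jrad th] /\
  [/\ RLA th < 1 <-> linearly_asymptotically_stable F E,
      RLA th = 1 <-> nonhyperbolic F E /\ ~ linearly_unstable F E &
      RLA th > 1 <-> linearly_unstable F E] /\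
  (RLA th <> 1 ->
     (RLA th < 1 <-> locally_asymptotically_stable F simplexT E) /\
     (RLA th > 1 <-> unstable F simplexT E)).
Proof.
move=> F E.
have thp : forall i, 0 < th 0 i by exact: Ppos.
have [dF jF] := frozen_jacobian thp.
split; first split.
- split; first exact: Edag_simplex.
  by split; [exact: Edag_radical_free|exact: Edag_equilibrium].
- by move=> x; exact: radical_free_equilibrium_unique.
- exact: Adag_itv.
- exact: CdagE.
- exact: Cdag_itv.
split; first by rewrite jF block_mxKur block_mxKul.
have [l [[hl l1 l2] [r1 r2 r3]]] := dominant_eigenvalue thp.
have [_ [[_ e0] r0]] := param_gt0 thp.
have sp z := spectrum_jacobian thp z hl.
have trl : \tr (Jrad th) - l < l.
  by rewrite JradE /mxtrace !big_ord_recl big_ord0 !mxE /=; lra.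
have spl : spectrum (jacobian_mx F E) (real_complex R l) by apply/sp; left.
split; first split.
- rewrite r1; split=> [l0 z /sp|st]; last by have := st _ spl.
  by move=> [->|[->|->]] /=; lra.
- rewrite r2; split=> [l0|[[z [/sp zs z0]] nu]].
    split; first by exists (real_complex R l); rewrite /= l0 -{1}l0.
    by move=> [z [/sp [->|[->|->]] /=]]; lra.
  have : ~~ (0 < l) by apply/negP => l0; apply: nu; exists (real_complex R l).
  by rewrite -leNgt => l0; move: zs z0 => [->|[->|->]] /=; lra.
- rewrite r3; split=> [l0|[z [/sp zs]]]; first by exists (real_complex R l).
  by move: zs => [->|[->|->]] /=; lra.
move=> R1.
have neg : l < 0 -> locally_asymptotically_stable F simplexT E.
  exact: (dominant_neg_stable thp hl l1).
have pos : 0 < l -> unstable F simplexT E.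
  exact: (dominant_pos_unstable thp hl l1).
have dich : l < 0 \/ 0 < l.
  by case: (ltgtP l 0) => [h|h|/r2 //]; [left|right].
rewrite r1 r3; split; split=> [//|]; case: dich => // l0 h.
- by case: (pos l0 h.1).
- by case: (h (neg l0).1).
Qed.
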